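(* Let $G$ be an infinite, connected, simple, undirected planar graph with all degrees finite, given with a locally finite planar embedding. Consider a rotor mechanism on $G$ such that at each vertex the cyclic order of the neighbours is either the clockwise order or the anticlockwise order in which the corresponding edges occur around the vertex in the embedding (possibly with different directions at different vertices). Then there exists a recurrent rotor configuration on $G$ for this rotor mechanism.
   Context: A planar embedding of a planar graph is locally finite if every bounded region of the plane contains only finitely many vertices. A rotor mechanism on a graph assigns to each vertex a fixed cyclic order of its neighbours (a single cycle through all neighbours). A rotor configuration assigns to each vertex one of its neighbours (the vertex its rotor points to). Given a rotor mechanism, an initial rotor configuration and a starting vertex for a particle, the rotor walk evolves in discrete time: at each step the rotor at the particle's current location is first incremented to point to the next neighbour in the cyclic order, and then the particle moves to this new neighbour. The rotor walk is recurrent if it visits every vertex infinitely many times. A rotor configuration is called recurrent if the rotor walk with it as initial configuration is recurrent for every starting vertex (on an infinite connected graph with all degrees finite, this is equivalent to recurrence for some starting vertex). *)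

(* Defs.v *)
From HB Require Import structures.
From mathcomp Require Import all_boot all_order all_algebra.
From mathcomp Require Import all_classical all_reals all_analysis.

Set Implicit Arguments.
Unset Strict Implicit.
Unset Printing Implicit Defensive.

Import Order.TTheory GRing.Theory Num.Theory.
Import numFieldNormedType.Exports.

Local Open Scope classical_set_scope.
Local Open Scope ring_scope.

Section Graph.
Context {V : choiceType}.
Implicit Types (e : rel V) (x y z : V).

Definition simple_graph e := symmetric e /\ irreflexive e.

Definition nbrs e x : set V := [set y | e x y].

Definition connected_graph e :=
  forall x y, exists2 p : seq V, path e x p & last x p = y.

(* [rot x y] is the successor of [y] in the cyclic order of the neighbours
   of [x]; its values are constrained only when [e x y].  When [nbrs e x] is
   finite, the reachability clause says that [rot x] permutes it in a single
   cycle. *)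
Definition rotor_mechanism e (rot : V -> V -> V) :=
  forall x y, e x y ->
    e x (rot x y) /\ forall z, e x z -> exists n, iter n (rot x) y = z.

Definition rotor_configuration e (rho : V -> V) := forall x, e x (rho x).

Definition rotor_step (rot : V -> V -> V) (s : V * (V -> V)) : V * (V -> V) :=
  let: (x, rho) := s in
  let y := rot x (rho x) in
  (y, fun z => if z == x then y else rho z).

Definition rotor_walk (rot : V -> V -> V) (rho : V -> V) x (n : nat) : V :=
  (iter n (rotor_step rot) (x, rho)).1.

Definition recurrent_walk (rot : V -> V -> V) (rho : V -> V) x :=
  forall y, infinite_set [set n | rotor_walk rot rho x n = y].

Definition recurrent_configuration (rot : V -> V -> V) (rho : V -> V) :=
  forall x, recurrent_walk rot rho x.

End Graph.

(* An edge {x, y} is drawn as one simple arc, parametrised on [0, 1] from x to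
   y by [edge_arc x y] and in the reverse direction by [edge_arc y x].  Values
   of [edge_arc] at non-edges or outside [0, 1] are irrelevant. *)
Record planar_embedding (R : realType) (V : choiceType) (e : rel V) := {
  pos : V -> R * R;
  edge_arc : V -> V -> R -> R * R;
  pos_inj : injective pos;
  arc_start : forall x y, e x y -> edge_arc x y 0 = pos x;
  arc_end : forall x y, e x y -> edge_arc x y 1 = pos y;
  arc_rev : forall x y t, e x y ->
    t \in `[0, 1] -> edge_arc y x t = edge_arc x y (1 - t);
  arc_continuous : forall x y, e x y ->
    {within `[0, 1], continuous (edge_arc x y)};
  arc_simple : forall x y, e x y -> {in `[0, 1] &, injective (edge_arc x y)};
  arc_avoids_vertices : forall x y z t,
    e x y -> t \in `]0, 1[ -> edge_arc x y t <> pos z;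
  arc_disjoint : forall x y x' y' t t', e x y -> e x' y' ->
    t \in `]0, 1[ -> t' \in `]0, 1[ -> edge_arc x y t = edge_arc x' y' t' ->
    (x = x' /\ y = y') \/ (x = y' /\ y = x')
}.

Section Embedding.
Context {R : realType} {V : choiceType} {e : rel V}.
Variable G : planar_embedding R e.
Implicit Types (p q s : R * R) (x y z : V).

Definition locally_finite_embedding :=
  forall A : set (R * R), bounded_set A -> finite_set [set x | A (pos G x)].

(* The norm of [R * R] is the sup norm, hence an explicit Euclidean one. *)
Definition sqdist p q : R := (p.1 - q.1) ^+ 2 + (p.2 - q.2) ^+ 2.

(* Twice the signed area of the triangle pqs is positive; for points of a
   common circle this says that p, q, s are distinct and occur in this order
   when the circle is traversed anticlockwise. *)
Definition ccw p q s : Prop :=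
  0 < (q.1 - p.1) * (s.2 - p.2) - (q.2 - p.2) * (s.1 - p.1).

(* [p] is the point at which the arc from x to y first reaches the circle of
   radius r around x. *)
Definition first_exit (r : R) x y p :=
  exists t, [/\ t \in `[0, 1], edge_arc G x y t = p,
    sqdist p (pos G x) = r ^+ 2
    & forall u, u \in `[0, t[ -> sqdist (edge_arc G x y u) (pos G x) < r ^+ 2].

(* The edges xy, xz, xw are distinct and leave x in this anticlockwise cyclic
   order.  The arcs being arbitrary continuous curves, they need not have
   tangent directions at x; the order is read off on small circles around x.
   Up to their first exit points the arcs are disjoint except at x, so this
   order does not depend on the (small) radius. *)
Definition anticlockwise x y z w :=
  \forall r \near 0^'+, exists p q s,
    [/\ first_exit r x y p, first_exit r x z q, first_exit r x w s & ccw p q s].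

(* For a cyclic order [rot x] of the neighbours of x, these say that no
   neighbour z of x lies strictly between y and its successor [rot x y] in the
   given sense of rotation; they are vacuous at degree at most 2, where the
   cyclic order is unique. *)
Definition anticlockwise_at (rot : V -> V -> V) x :=
  forall y z, e x y -> e x z -> z <> y -> z <> rot x y ->
    anticlockwise x y (rot x y) z.

Definition clockwise_at (rot : V -> V -> V) x :=
  forall y z, e x y -> e x z -> z <> y -> z <> rot x y ->
    anticlockwise x (rot x y) y z.

End Embedding.

(* Main.v *)
Require Import Defs.
From HB Require Import structures.
From mathcomp Require Import all_boot all_order all_algebra.
From mathcomp Require Import all_classical all_reals all_analysis.
From mathcomp Require Import ring lra zify.

(* Suppose that the walk leaves a finite set U containing its last visit to the
   start x0 and everything it has seen before, and never comes back to x0.  By a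
   maximum principle it uses every directed edge at most once from then on.  If
   at every vertex x of the outer boundary of U the initial rotor meets the
   neighbours in U before those from which the walk can escape, then x has
   already sent one particle to each of its neighbours in U when it first sends
   one outwards, and the net flow from U to x cannot be positive; but the net
   flow out of U is one.  So it suffices to exhaust the graph by finite sets with
   disjoint boundaries and to choose such rotors on the boundaries.

   Such a rotor fails to exist only if four neighbours b1, y1, b2, y2 of x occur
   in this cyclic order, with b1 and b2 joined inside U by a path that closes up
   to a cycle through x, and with y1 and y2 joined to vertices far away outside
   the cycle.  In place of the Jordan curve theorem, the parity of the winding
   number of the cycle around a moving point is computed along finite chains of
   nearby points: it vanishes far away, hence at points of the arcs x y1 and x y2
   close to x, while within a small disc around x the cyclic order forces the two
   parities to differ. *)

Set Implicit Arguments.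
Unset Strict Implicit.
Unset Printing Implicit Defensive.

Import Order.TTheory GRing.Theory Num.Theory.
Import numFieldNormedType.Exports.

(** * Flows and rotor walks *)

Section Flow.
Variables (V : eqType) (X : nat -> V).
Implicit Types (P Q : pred V) (n : nat).

Definition flow n P Q := \sum_(k < n) (P (X k) && Q (X k.+1)).

Lemma flow0 P Q : flow 0 P Q = 0.
Proof. by rewrite /flow big_ord0. Qed.

Lemma flowS n P Q :
  flow n.+1 P Q = flow n P Q + (P (X n) && Q (X n.+1)).
Proof. by rewrite /flow big_ord_recr. Qed.

(** Exits from [P] and entries into [P] alternate, so their numbers can differ only through the two
    ends of the walk. *)
Lemma flow_balance n P :
  flow n P (predC P) + P (X n) = flow n (predC P) P + P (X 0).
Proof.
elim: n => [|n IHn]; first by rewrite !flow0.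
move: IHn; rewrite !flowS /=.
case: (P (X n)); case: (P (X n.+1)) => /=; lia.
Qed.

Lemma flow_splitl n P P1 P2 Q :
    (forall v, P v -> (P1 v : nat) + P2 v = 1) ->
  flow n P Q = flow n (predI P P1) Q + flow n (predI P P2) Q.
Proof.
move=> H; rewrite /flow -big_split /=; apply: eq_bigr => k _.
by have := H (X k); case: (P _) (P1 _) (P2 _) (Q _) => [] [] [] [] //= /(_ isT).
Qed.

Lemma flow_splitr n P Q Q1 Q2 :
    (forall v, Q v -> (Q1 v : nat) + Q2 v = 1) ->
  flow n P Q = flow n P (predI Q Q1) + flow n P (predI Q Q2).
Proof.
move=> H; rewrite /flow -big_split /=; apply: eq_bigr => k _.
by have := H (X k.+1); case: (Q _) (Q1 _) (Q2 _) (P _) => [] [] [] [] //= /(_ isT).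
Qed.

Lemma eq_flow n P Q P' Q' :
    (forall k, k < n ->
       P (X k) && Q (X k.+1) = P' (X k) && Q' (X k.+1)) ->
  flow n P Q = flow n P' Q'.
Proof. by move=> H; apply: eq_bigr => k _; rewrite H. Qed.

Lemma leq_flow n P Q P' Q' :
    (forall k, k < n -> P (X k) && Q (X k.+1) -> P' (X k) && Q' (X k.+1)) ->
  flow n P Q <= flow n P' Q'.
Proof.
move=> H; apply: leq_sum => k _; have := H k (ltn_ord k).
by case: (_ && _) => // ->.
Qed.

Lemma sum_pred1 (v : V) (s : seq V) : uniq s ->
  (v \in s : nat) = \sum_(w <- s) (v == w).
Proof.
move=> us; rewrite -(count_uniq_mem _ us) -sum1_count big_mkcond.
by apply: eq_bigr => w _; rewrite /= eq_sym; case: (_ == _).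
Qed.

Lemma flow_sumr n P (s : seq V) : uniq s ->
  flow n P (mem s) = \sum_(v <- s) flow n P (pred1 v).
Proof.
move=> us; rewrite /flow exchange_big /=; apply: eq_bigr => k _.
case: (P _) => /=; last by rewrite big1.
exact: sum_pred1.
Qed.

Lemma flow_suml n (s : seq V) Q : uniq s ->
  flow n (mem s) Q = \sum_(v <- s) flow n (pred1 v) Q.
Proof.
move=> us; rewrite /flow exchange_big /=; apply: eq_bigr => k _.
case: (Q _) => /=; last first.
  by rewrite andbF big1 // => v _; rewrite andbF.
rewrite andbT (eq_bigr (fun v => nat_of_bool (X k == v))); last first.
  by move=> v _; rewrite andbT.
exact: sum_pred1.
Qed.

End Flow.

(** * Departures along the cyclic order, and cuts that the walk cannot leave *)

Section RotorWalk.
Variables (V : choiceType) (e : rel V) (rot : V -> V -> V).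
Hypothesis rotM : rotor_mechanism e rot.

Lemma rot_edge x y i : e x y -> e x (iter i (rot x) y).
Proof. by move=> exy; elim: i => //= i IHi; have [] := rotM IHi. Qed.

Section Orbit.
Variables (x y : V) (N : seq V).
Hypotheses (uN : uniq N) (memN : forall z, (z \in N) = e x z) (exy : e x y).

Lemma traject_rot_sub i : {subset traject (rot x) y i <= N}.
Proof. by move=> z /trajectP[j _ ->]; rewrite memN rot_edge. Qed.

(** A repetition among the first [size N] iterates would close the orbit early, but the orbit
    reaches every neighbour. *)
Lemma uniq_traject_rot : uniq (traject (rot x) y (size N)).
Proof.
case sN: (size N) => [//|n]; rewrite looping_uniq; apply/negP => /loopingP lp.
have : size N <= size (traject (rot x) y n).
  apply: uniq_leq_size => // z; rewrite memN => exz.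
  by have [m <-] := (rotM exy).2 z exz.
by rewrite sN size_traject ltnn.
Qed.

Lemma mem_traject_rot z : (z \in traject (rot x) y (size N)) = e x z.
Proof.
have le_sz : size N <= size (traject (rot x) y (size N)) by rewrite size_traject.
by have [_ ->] := uniq_min_size uniq_traject_rot (@traject_rot_sub _) le_sz.
Qed.

End Orbit.

Lemma iter_rot_size x y (N : seq V) : uniq N ->
  (forall z, (z \in N) = e x z) -> e x y -> iter (size N) (rot x) y = y.
Proof.
move=> uN memN exy.
have /trajectP[i lti eqi] : iter (size N) (rot x) y \in traject (rot x) y (size N).
  by rewrite (mem_traject_rot uN memN) // rot_edge.
case: i => [|i] in lti eqi *; first by rewrite eqi.
(* If the last iterate were the later point [y'], then [y'] would recur after fewer than [size N]
   steps, against [uniq_traject_rot] started at [y']. *)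
set y' := iter i.+1 (rot x) y in eqi.
have ey' : e x y' by apply: rot_edge.
have := uniq_traject_rot uN memN ey'.
have -> : size N = (size N - i.+1) + i.+1 by rewrite subnK // ltnW.
rewrite trajectD cat_uniq => /and3P[_ /hasPn/(_ y')].
have -> : iter (size N - i.+1) (rot x) y' = y'.
  by rewrite /y' -iterD subnK // ltnW.
rewrite mem_head => /(_ isT).
by rewrite -[size N - _]prednK ?subn_gt0 // mem_head.
Qed.

Variables (rho : V -> V) (x0 : V).
Hypothesis rho_conf : rotor_configuration e rho.
Let X := rotor_walk rot rho x0.
Let visits n v := \sum_(k < n) (X k == v).
(** The destinations of the first departures from [v], in order. The list starts at [rot v (rho v)]
    because a rotor turns before the particle moves. *)
Let exits v := traject (rot v) (rot v (rho v)).

Lemma rotor_state n v :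
  (iter n (rotor_step rot) (x0, rho)).2 v = iter (visits n v) (rot v) (rho v).
Proof.
elim: n => [|n IHn]; rewrite /visits ?big_ord0 // big_ord_recr /= -/(visits n v).
rewrite /X /rotor_walk; case: (iter n _ _) IHn => w sg /= IHn.
rewrite (eq_sym v); case: eqVneq => [->|_]; last by rewrite addn0.
by rewrite addn1 /= IHn.
Qed.

Lemma rotor_walkS n :
  X n.+1 = iter (visits n (X n)).+1 (rot (X n)) (rho (X n)).
Proof.
rewrite /= -rotor_state /X /rotor_walk /=.
by case: (iter n _ _).
Qed.

Lemma rotor_walk_edge n : e (X n) (X n.+1).
Proof. by rewrite rotor_walkS rot_edge. Qed.

Lemma flow_exits n v (Q : pred V) :
  flow X n (pred1 v) Q = count Q (exits v (visits n v)).
Proof.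
elim: n => [|n IHn]; first by rewrite flow0 /visits big_ord0.
rewrite flowS IHn /visits big_ord_recr /= -/(visits n v).
case: eqVneq => [Xn|_]; last by rewrite !addn0.
by rewrite addn1 /exits trajectSr -cats1 count_cat /= addn0 rotor_walkS Xn iterSr.
Qed.

Variable N : V -> seq V.
Hypotheses (uN : forall v, uniq (N v)) (memN : forall v w, (w \in N v) = e v w).
Hypothesis (sym_e : symmetric e).
Hypothesis noreturn : forall n, X n.+1 != x0.

Lemma visits_flow n v : visits n v = flow X n (pred1 v) predT.
Proof. by apply: eq_bigr => k _ /=; rewrite andbT. Qed.

(** Within one turn of the rotor the destinations are distinct. *)
Lemma flow_edge_le1 n v w : visits n v <= size (N v) ->
  flow X n (pred1 v) (pred1 w) <= 1.
Proof.
move=> le_vis; rewrite flow_exits.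
have erv : e v (rot v (rho v)) by apply: (@rot_edge _ _ 1).
have := uniq_traject_rot (uN v) (memN v) erv.
rewrite -(subnKC le_vis) trajectD cat_uniq => /andP[u _].
by rewrite count_uniq_mem // leq_b1.
Qed.

Lemma flow_in_le n v (s : seq V) : (forall w, visits n w <= size (N w)) ->
  uniq s -> flow X n (mem s) (pred1 v) <= size s.
Proof.
move=> vis us; rewrite flow_suml // -sum1_size; apply: leq_sum => w _.
exact: flow_edge_le1.
Qed.

(** This is [flow_balance] for a single vertex, with the steps from [v] to itself added on both
    sides. *)
Lemma visits_balance n v :
  visits n v + (X n == v) = flow X n predT (pred1 v) + (x0 == v).
Proof.
have := flow_balance X n (pred1 v); rewrite /= {3}/X /rotor_walk /= => bal.
rewrite visits_flow.
rewrite (@flow_splitr _ _ n (pred1 v) predT (predC (pred1 v)) (pred1 v)); last first.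
  by move=> w _ /=; case: eqP.
rewrite (@flow_splitl _ _ n predT (predC (pred1 v)) (pred1 v)); last first.
  by move=> w _ /=; case: eqP.
have -> : flow X n (pred1 v) (predI predT (predC (pred1 v))) =
          flow X n (pred1 v) (predC (pred1 v)) by [].
have -> : flow X n (predI predT (predC (pred1 v))) (pred1 v) =
          flow X n (predC (pred1 v)) (pred1 v) by [].
have -> : flow X n (pred1 v) (predI predT (pred1 v)) =
          flow X n (predI predT (pred1 v)) (pred1 v) by [].
by rewrite addnAC bal addnAC.
Qed.

(* Maximum principle: the first vertex to be left more than once through some
   edge would have been entered more than once through some edge, so it can
   only be the starting point. *)
Lemma visits_le n v : visits n v <= size (N v).
Proof.
elim: n v => [|n IHn] v; first by rewrite /visits big_ord0.
rewrite /visits big_ord_recr /= -/(visits n v).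
case: eqVneq => [Xn|_]; last by rewrite addn0.
(* At time zero the walk stands at the start, and the bound only asks for one neighbour. *)
case: n => [|n] in IHn Xn *.
  rewrite /visits big_ord0 add0n /=; have := memN v (rho v); rewrite rho_conf.
  by case: (N v).
have vx0 : x0 != v by rewrite -Xn eq_sym noreturn.
have := visits_balance n.+1 v.
rewrite Xn eqxx (negbTE vx0) addn0 => ->.
apply: leq_trans (flow_in_le v IHn (uN v)); apply: leq_flow => k _ /=.
by move=> /eqP Xk; rewrite Xk eqxx andbT memN sym_e -Xk rotor_walk_edge.
Qed.

(* A pocket [P] hanging at [x] is exempt: a particle sent into it has to come
   back to [x]. *)
Definition inner_first (U P : seq V) x y :=
  forall i j, 0 < i < j -> j <= size (N x) ->
    iter j (rot x) y \in U -> iter i (rot x) y \notin P ->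
    iter i (rot x) y \in U.

Definition pocket (P : seq V) x :=
  x \notin P /\ forall v w, v \in P -> e v w -> w \notin P -> w = x.

Section Cut.
Variables (U P : seq V) (x : V) (n : nat).
Hypotheses (pocketP : pocket P x) (PU : forall v, v \in P -> e x v -> v \notin U).
Hypotheses (xx0 : x0 != x) (xXn : X n != x) (x0P : x0 \notin P) (XnP : X n \notin P).
Hypothesis inner : inner_first U P x (rho x).

(** All edges leaving [P] end at [x], and the walk starts and ends outside [P]. *)
Lemma pocket_flow : flow X n (mem P) (pred1 x) = flow X n (pred1 x) (mem P).
Proof.
have := flow_balance X n (mem P); rewrite /= {3}/X /rotor_walk /=.
rewrite (negbTE x0P) (negbTE XnP) !addn0 => bal.
transitivity (flow X n (mem P) (predC (mem P))).
  apply: eq_flow => k _ /=; case XkP: (X k \in P) => //=.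
  case: eqVneq => [->|neq]; first by rewrite (proj1 pocketP).
  apply/esym/negbTE/negP => XSP.
  by case/eqP: neq; apply: (proj2 pocketP) XkP _ XSP; apply: rotor_walk_edge.
rewrite bal; apply: eq_flow => k _ /=.
case XkP: (X k.+1 \in P); last by rewrite !andbF.
rewrite !andbT; case: eqVneq => [->|neq]; first by rewrite (proj1 pocketP).
apply/negbTE/negP => XSP; case/eqP: neq; apply: (proj2 pocketP) XkP _ XSP.
by rewrite sym_e rotor_walk_edge.
Qed.

(** If [x] has sent a particle outside [U] and [P], it has already served each of its neighbours in
    [U], while each edge from [U] to [x] is used at most once. Otherwise every departure goes to [U]
    or [P], and the exchange with [P] cancels. *)
Lemma cut_flow_le : flow X n (mem U) (pred1 x) <= flow X n (pred1 x) (mem U).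
Proof.
have erx : e x (rot x (rho x)) by apply: (@rot_edge _ _ 1).
have le_vis := visits_le n x.
rewrite flow_exits; have [out|noout] := boolP (has [pred w | (w \notin U) && (w \notin P)]
  (exits x (visits n x))).
(* After the outward exit the rest of the turn contains no neighbour in [U], so the count is already
   that of a full turn. *)
- have <- : count (mem U) (exits x (size (N x))) =
            count (mem U) (exits x (visits n x)).
    rewrite -(subnKC le_vis) /exits trajectD count_cat -[RHS]addn0.
    congr addn; apply/eqP; rewrite -leqn0 leqNgt -has_count; apply/negP.
    case/hasP: out => _ /trajectP[i lti ->] /= /andP[/negP niU niP].
    case/hasP=> _ /trajectP[j ltj ->] /= jU; apply: niU.
    rewrite -iterD -!iterSr in jU niP *; apply: inner jU niP; last by lia.
    by lia.
  have -> : count (mem U) (exits x (size (N x))) = size [seq w <- N x | w \in U].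
    rewrite size_filter; apply/permP; apply: uniq_perm => //.
      exact: uniq_traject_rot.
    by move=> w; rewrite mem_traject_rot.
  apply: leq_trans (flow_in_le x (visits_le n) (filter_uniq _ (uN x))).
  apply: leq_flow => k _ /= /andP[XU /eqP Xx]; rewrite Xx eqxx andbT.
  by rewrite mem_filter memN sym_e -Xx rotor_walk_edge /= XU.
have := visits_balance n x; rewrite (negbTE xx0) (negbTE xXn) !addn0 => bal.
have sz : visits n x = count (mem U) (exits x (visits n x)) +
                    count (mem P) (exits x (visits n x)).
  rewrite -{1}[visits n x](size_traject (rot x) (rot x (rho x))) -/(exits x _).
  rewrite -count_predUI -[LHS]addn0; congr addn.
    apply/esym/eqP; rewrite -all_count; apply/allP => w ws /=.
    by have /hasPn/(_ w ws) := noout; rewrite /= -negb_or negbK.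
  apply/eqP; rewrite eq_sym -leqn0 leqNgt -has_count; apply/hasPn => w ws /=.
  apply/negP => /andP[wU wP]; move: ws => /trajectP[i _ wi].
  have exw : e x w by rewrite wi -iterSr; apply: rot_edge.
  by have := PU wP exw; rewrite [w \in U]wU.
(* Adding the flow into [P], which equals the flow back from [P], turns the claim into a bound by
   all arrivals at [x]. *)
rewrite -(leq_add2r (count (mem P) (exits x (visits n x)))) -sz.
have <- : flow X n (pred1 x) (mem P) = count (mem P) (exits x (visits n x)).
  exact: flow_exits.
rewrite bal -pocket_flow /flow -big_split; apply: leq_sum => k _ /=.
case: eqVneq => [Xx|_]; rewrite ?andbF ?andbT //=.
case XU: (X k \in U); case XP: (X k \in P) => //.
by have := @PU _ XP; rewrite XU sym_e -Xx rotor_walk_edge => /(_ isT).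
Qed.

End Cut.

(** Were [X n] outside [U], the net flow out of [U] would be one, yet it is a sum over boundary
    vertices of terms that [cut_flow_le] makes nonpositive. *)
Lemma no_escape (U : seq V) n : x0 \in U ->
    (forall x, x \notin U -> (exists2 u, u \in U & e x u) ->
      X n != x /\ exists P : seq V,
        [/\ pocket P x, (forall v, v \in P -> e x v -> v \notin U),
            x0 \notin P, X n \notin P & inner_first U P x (rho x)]) ->
  X n \in U.
Proof.
move=> x0U bd; apply/negPn/negP => XnU.
pose D := undup [seq w <- flatten [seq N u | u <- U] | w \notin U].
have memD w : w \in D -> w \notin U /\ exists2 u, u \in U & e w u.
  rewrite mem_undup mem_filter => /andP[-> /flattenP[_ /mapP[u uU ->]]].
  by rewrite memN sym_e => ewu; split => //; exists u.
have Dmem v w : v \in U -> e v w -> w \notin U -> w \in D.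
  move=> vU evw wU; rewrite mem_undup mem_filter wU; apply/flattenP.
  by exists (N v); [exact: map_f | rewrite memN].
have := flow_balance X n (mem U); rewrite /= {3}/X /rotor_walk /=.
rewrite x0U (negbTE XnU) addn0 => bal.
have : flow X n (mem U) (predC (mem U)) <= flow X n (predC (mem U)) (mem U).
  have -> : flow X n (mem U) (predC (mem U)) = flow X n (mem U) (mem D).
    apply: eq_flow => k _ /=; case XU: (X k \in U) => //=.
    apply/idP/idP => [XSU|/memD[]//].
    exact: Dmem XU (rotor_walk_edge k) XSU.
  have -> : flow X n (predC (mem U)) (mem U) = flow X n (mem D) (mem U).
    apply: eq_flow => k _ /=; case XU: (X k.+1 \in U); rewrite ?andbF ?andbT //.
    apply/idP/idP => [XSU|/memD[]//].
    by apply: Dmem XU _ XSU; rewrite sym_e rotor_walk_edge.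
  have uD : uniq D by apply: undup_uniq.
  rewrite flow_sumr // flow_suml // big_seq [leqRHS]big_seq.
  apply: leq_sum => w /memD[wU wnb].
  have [Xnw [P [pP PU x0P XnP inner]]] := bd w wU wnb.
  apply: (@cut_flow_le U P w n) => //.
  by apply: contraNneq wU => <-.
by rewrite bal addn1 ltnn.
Qed.

End RotorWalk.

(** * Recurrence from a family of cuts *)

Section Recurrence.
Variables (V : choiceType) (e : rel V) (rot : V -> V -> V).
Hypothesis rotM : rotor_mechanism e rot.

Definition visited_often rho x v :=
  forall m, exists2 n, m <= n & rotor_walk rot rho x n = v.

Lemma visited_often_infinite rho x v : visited_often rho x v ->
  infinite_set [set n | rotor_walk rot rho x n = v]%classic.
Proof.
move=> io /finite_seqP[s sE]; have [n lt_n Xn] := io (\max_(k <- s) k).+1.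
have : n \in s by have : [set` s]%classic n by rewrite -sE.
move=> ns; have := @leq_bigmax_seq _ s xpredT id n ns isT.
by rewrite leqNgt lt_n.
Qed.

Definition rotor_config rho x n : V -> V := (iter n (rotor_step rot) (x, rho)).2.

Lemma rotor_walkD rho x m n : rotor_walk rot rho x (n + m) =
  rotor_walk rot (rotor_config rho x m) (rotor_walk rot rho x m) n.
Proof. by rewrite /rotor_walk iterD /rotor_config; case: (iter m _ _). Qed.

Lemma rotor_config_edge rho x n :
  rotor_configuration e rho -> rotor_configuration e (rotor_config rho x n).
Proof. by move=> rho_e v; rewrite /rotor_config rotor_state; apply: (rot_edge rotM). Qed.

(** The number of earlier visits determines the rotor, so this picks a visit at which the rotor
    turns to a prescribed neighbour. *)
Lemma nth_visit rho x v i : visited_often rho x v ->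
  exists2 k, rotor_walk rot rho x k = v &
             \sum_(j < k) (rotor_walk rot rho x j == v) = i.
Proof.
set X := rotor_walk rot rho x => io.
have next k : exists2 l, X l = v & \sum_(j < l) (X j == v) = \sum_(j < k) (X j == v).
  have exl : exists l, (k <= l) && (X l == v).
    by have [l kl Xl] := io k; exists l; rewrite kl; apply/eqP.
  case: (ex_minnP exl) => l /andP[kl /eqP Xl] lmin; exists l => //.
  rewrite -(subnKC kl) big_split_ord /= [X in _ + X]big1 ?addn0 // => j _.
  apply/eqP; rewrite eqb0; apply/negP => Xj.
  have := lmin (k + j); rewrite leq_addr Xj => /(_ isT).
  by have := ltn_ord j; lia.
elim: i => [|i [k Xk IHi]].
  by have [l Xl lE] := next 0; exists l; rewrite // lE big_ord0.
have [l Xl lE] := next k.+1; exists l => //.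
by rewrite lE big_ord_recr /= IHi -/X Xk eqxx addn1.
Qed.

Lemma visited_often_edge rho x v w : rotor_configuration e rho ->
  visited_often rho x v -> e v w -> visited_often rho x w.
Proof.
move=> rho_e io evw m.
set rho' := rotor_config rho x m; set x' := rotor_walk rot rho x m.
have io' : visited_often rho' x' v.
  move=> k; have [n lt_n Xn] := io (k + m); exists (n - m); first by lia.
  by rewrite -rotor_walkD subnK // (leq_trans _ lt_n) // leq_addl.
have rho'_e : rotor_configuration e rho' by apply: rotor_config_edge.
(* The first departure already uses one increment, so the visit with [i] predecessors leads to
   [w]. *)
have [i iE] := (rotM (rot_edge rotM 1 (rho'_e v))).2 w evw.
have [k Xk vis] := nth_visit i io'; exists (k.+1 + m); first exact: leq_addl.
by rewrite rotor_walkD rotor_walkS -/x' -/rho' Xk vis iterSr.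
Qed.

Lemma visited_often_connected rho x v w : connected_graph e ->
  rotor_configuration e rho -> visited_often rho x v -> visited_often rho x w.
Proof.
move=> conn rho_e io; have [p] := conn v w.
elim: p v io => [|u p IHp] v io /=; first by move=> _ <-.
by case/andP=> evu; apply: IHp; apply: visited_often_edge evu.
Qed.

Variable N : V -> seq V.
Hypotheses (uN : forall v, uniq (N v)) (memN : forall v w, (w \in N v) = e v w).
Hypotheses (sym_e : symmetric e) (conn : connected_graph e).

(** In use [A] holds the vertices seen up to the last visit to the start, so a pocket missing [A]
    does not contain the start. *)
Definition good_cut (A U : seq V) x y := exists P : seq V,
  [/\ pocket e P x, (forall v, v \in P -> e x v -> v \notin U),
      (forall v, v \in A -> v \notin P) & inner_first rot N U P x y].

(** If the start were visited finitely often, then by connectedness so would every vertex. Restarted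
    at its last visit to the start, the walk would leave the finite set [U] for good, against
    [no_escape]. *)
Lemma recurrent_of_cuts rho : rotor_configuration e rho ->
    (forall A : seq V, exists2 U : seq V, {subset A <= U} &
      forall x, x \notin U -> (exists2 u, u \in U & e x u) ->
        good_cut A U x (rho x)) ->
  recurrent_configuration rot rho.
Proof.
move=> rho_e cuts x0 y; apply: visited_often_infinite.
apply: (@visited_often_connected _ _ x0) => //.
set X := rotor_walk rot rho x0.
apply: contrapT => nio.
have {nio} [M lastM] : exists M, forall n, X n = x0 -> n <= M.
  apply: contrapT => H; apply: nio => m; apply: contrapT => Hm; apply: H.
  exists m => n Xn.
  by rewrite leqNgt; apply/negP => lt; apply: Hm; exists n => //; apply: ltnW.
have notio v : exists m, forall n, m <= n -> X n <> v.
  apply: contrapT => H.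
  have : visited_often rho x0 x0.
    apply: (@visited_often_connected _ _ v) => // m; apply: contrapT => Hm.
    by apply: H; exists m => n le_n Xn; apply: Hm; exists n.
  by move=> /(_ M.+1)[n lt_n /lastM]; rewrite leqNgt lt_n.
have exT : exists T, X T == x0 by exists 0.
have maxT T : X T == x0 -> T <= M by move/eqP/lastM.
case: (ex_maxnP exT maxT) => T /eqP XT lastT {lastM maxT exT}.
pose A := [seq X k | k <- iota 0 T.+1].
have memA k : k <= T -> X k \in A by move=> le_k; apply: map_f; rewrite mem_iota.
have [U AU Ucut] := cuts A.
have {Ucut} [Pf Pf_cut] : exists Pf : V -> seq V, forall x, x \notin U ->
    (exists2 u, u \in U & e x u) ->
    [/\ pocket e (Pf x) x, (forall v, v \in Pf x -> e x v -> v \notin U),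
      (forall v, v \in A -> v \notin Pf x) & inner_first rot N U (Pf x) x (rho x)].
  have /choice[Pf PfE] : forall x, exists P : seq V, x \notin U ->
      (exists2 u, u \in U & e x u) ->
    [/\ pocket e P x, (forall v, v \in P -> e x v -> v \notin U),
      (forall v, v \in A -> v \notin P) & inner_first rot N U P x (rho x)].
    move=> x; have [xU|xU] := boolP (x \in U); first by exists [::].
    have [nb|nb] := pselect (exists2 u, u \in U & e x u); last by exists [::].
    by have [P HP] := Ucut x xU nb; exists P.
  by exists Pf.
pose D := flatten [seq N u | u <- U].
(* A finite list, so from some time on the walk avoids [U], its boundary and all the chosen pockets
   at once. *)
pose L := U ++ D ++ flatten [seq Pf x | x <- D].
have [m mL] : exists m, forall n, m <= n -> X n \notin L.
  elim: L => [|v L [m Hm]]; first by exists 0.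
  have [m' Hm'] := notio v; exists (maxn m m') => n; rewrite geq_max => /andP[le_m le_m'].
  by rewrite inE negb_or Hm // andbT; apply/eqP/Hm'.
have {mL} := mL (m + T) (leq_addr _ _); rewrite !mem_cat !negb_or => /and3P[XU XD XP].
have walkE n : rotor_walk rot (rotor_config rho x0 T) x0 n = X (n + T).
  by rewrite /X rotor_walkD -/X XT.
case/negP: XU; rewrite -walkE.
have x0A : x0 \in A by rewrite -XT memA.
apply: (no_escape rotM _ uN memN sym_e) => //.
- exact: rotor_config_edge.
- move=> n; rewrite walkE; apply/negP => /lastT.
  by rewrite leqNgt addSn ltnS leq_addl.
- exact: AU.
move=> x xU xnb; have xD : x \in D.
  case: xnb => u uU exu; apply/flattenP; exists (N u); first exact: map_f.
  by rewrite memN sym_e.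
rewrite walkE; split; first by apply: contraNneq XD => ->.
have [pP PU AP inner] := Pf_cut x xU xnb; exists (Pf x); split => //.
- exact: AP.
- by apply: contra XP => XP; apply/flattenP; exists (Pf x) => //; apply: map_f.
(* Vertices left before time [T] lie in [A], hence in [U], so the rotor at [x] is still the initial
   one. *)
rewrite /rotor_config rotor_state big1 // => k _; apply/eqP; rewrite eqb0.
by apply: contraNneq xU => <-; apply/AU/memA/ltnW.
Qed.

End Recurrence.

(** * Crossing parity of chains in the plane *)

Section Crossing.
Local Open Scope classical_set_scope.
Local Open Scope ring_scope.
Variable R : realType.
Implicit Types d h u v w p q z : R * R.

Definition dotp u v : R := u.1 * v.1 + u.2 * v.2.
Definition detp u v : R := u.1 * v.2 - u.2 * v.1.

(** Points on the line spanned by [d] count as nonnegative, so that no general position is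
    required. *)
Definition side d u : bool := 0 <= detp d u.

(* Whether the segment from [u] to [v] crosses the ray spanned by [d]: the point
   at which it meets the line spanned by [d] is a positive multiple of
   [`|detp d v| *: u + `|detp d u| *: v]. *)
Definition crosses d u v : bool :=
  (side d u (+) side d v) &&
  (0 < `|detp d v| * dotp u d + `|detp d u| * dotp v d).

(* In an open half-plane only one half of the line spanned by [d] is visible, so
   crossings of the ray are a coboundary. *)
Lemma crosses_half d h u v : 0 < dotp h u -> 0 < dotp h v ->
  crosses d u v = (0 < dotp h d) && (side d u (+) side d v).
Proof.
move=> hu hv; rewrite /crosses andbC; case suv: (_ (+) _); rewrite ?andbF ?andbT //.
set a := `|detp d v|; set b := `|detp d u|.
have [a0 b0] : 0 <= a /\ 0 <= b by split; apply: normr_ge0.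
(* The combination of [u] and [v] with weights [a] and [b] lies on the line spanned by [d]. *)
have dw : a * detp d u + b * detp d v = 0.
  move: suv; rewrite /side /a /b.
  have [du|du] := leP 0 (detp d u); have [dv|dv] //= := leP 0 (detp d v) => _.
    by rewrite (ltr0_norm dv) (ger0_norm du); ring.
  by rewrite (ltr0_norm du) (ger0_norm dv); ring.
have ab : 0 < a \/ 0 < b.
  move: suv; rewrite /side /a /b !normr_gt0.
  have [du|du] := leP 0 (detp d u); have [dv|dv] //= := leP 0 (detp d v) => _.
    by left; rewrite lt_eqF.
  by right; rewrite lt_eqF.
have hw : 0 < a * dotp h u + b * dotp h v.
  by case: ab => ?; [apply: ltr_pwDl | apply: ltr_wpDl];
    rewrite ?mulr_gt0 ?mulr_ge0 // ltW.
have dd : 0 < dotp d d.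
  rewrite lt_def addr_ge0 -?expr2 ?sqr_ge0 // andbT; apply/negP.
  rewrite /dotp -!expr2 paddr_eq0 ?sqr_ge0 // !sqrf_eq0 => /andP[/eqP d1 /eqP d2].
  by case: ab; rewrite /a /b /detp d1 d2 !mul0r subrr normr0 ltxx.
(* Expansion of that point along [d] and its normal, paired with [h]; the normal term vanishes by
   [dw]. *)
have key : dotp d d * (a * dotp h u + b * dotp h v) =
           (a * dotp u d + b * dotp v d) * dotp h d +
           (a * detp d u + b * detp d v) * detp d h.
  by rewrite /dotp /detp; ring.
have pos : 0 < (a * dotp u d + b * dotp v d) * dotp h d.
  by have := mulr_gt0 dd hw; rewrite key dw mul0r addr0.
apply/idP/idP => H; first by rewrite pmulr_rgt0 in pos.
by rewrite pmulr_lgt0 in pos.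
Qed.

Fixpoint chain_sum (T : Type) (c : T -> T -> bool) (p : T) (s : seq T) : bool :=
  if s is q :: s' then c p q (+) chain_sum c q s' else false.

(** The ray starts at [z]. Summed over a closed polygon missing [z], this gives the parity of the
    winding number around [z]. *)
Definition seen_from d z p q := crosses d (p - z) (q - z).

(** By [crosses_half] each term is a difference of sides, and the sum telescopes. *)
Lemma chain_sum_half d h (v : R * R -> R * R) p s :
    (forall q, q \in p :: s -> 0 < dotp h (v q)) ->
  chain_sum (fun p q => crosses d (v p) (v q)) p s =
  (0 < dotp h d) && (side d (v p) (+) side d (v (last p s))).
Proof.
elim: s p => [|q s IHs] p H /=; first by rewrite addbb andbF.
rewrite IHs => [|w ws]; last by apply: H; rewrite inE ws orbT.
rewrite (@crosses_half _ h) ?H ?mem_head // ?inE ?eqxx ?orbT //.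
case: (_ < _) => //=; move: (side d (v p)) (side d (v q)).
by case; case; case: (side _ _).
Qed.

Definition halfplane4 u1 u2 u3 u4 := exists h,
  [/\ 0 < dotp h u1, 0 < dotp h u2, 0 < dotp h u3 & 0 < dotp h u4].

(** In each cell the four crossings cancel by [crosses_half], and the terms shared by consecutive
    cells occur twice. *)
Lemma chain_sum_strip d z z' p s :
    path (fun a b => `[< halfplane4 (a - z) (b - z) (a - z') (b - z') >]) p s ->
  chain_sum (seen_from d z) p s (+) chain_sum (seen_from d z') p s =
  crosses d (p - z) (p - z') (+) crosses d (last p s - z) (last p s - z').
Proof.
elim: s p => [|q s IHs] p /=; first by rewrite addbb.
case/andP=> /asboolP[h [h1 h2 h3 h4]] /IHs {}IHs.
rewrite addbACA IHs /seen_from.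
rewrite (crosses_half d h1 h2) (crosses_half d h3 h4).
rewrite (crosses_half d h2 h4) (crosses_half d h1 h3).
move: (side d (p - z)) (side d (q - z)) (side d (p - z')) (side d (q - z')) (0 < _).
by do 5!case; case: (crosses _ _ _).
Qed.

(* Discrete homotopy invariance: every cell of the grid spanned by the two chains
   contributes zero, so that only the boundary of the grid counts. *)
Lemma chain_sum_rect d p s z t :
    path (fun z z' => path (fun a b =>
      `[< halfplane4 (a - z) (b - z) (a - z') (b - z') >]) p s) z t ->
  chain_sum (seen_from d z) p s (+) chain_sum (seen_from d (last z t)) p s =
  chain_sum (fun z z' => crosses d (p - z) (p - z')) z t (+)
  chain_sum (fun z z' => crosses d (last p s - z) (last p s - z')) z t.
Proof.
elim: t z => [|z' t IHt] z /=; first by rewrite addbb.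
case/andP=> /(chain_sum_strip d) H /IHt {}IHt.
rewrite addbACA -H -IHt.
by do 3!case: (chain_sum _ _ _).
Qed.

End Crossing.

(** * Fine chains in sets at positive distance *)

Section Chains.
Local Open Scope classical_set_scope.
Local Open Scope ring_scope.
Variable R : realType.
Implicit Types (s t : seq (R * R)) (d h u v w p q z : R * R) (K L : set (R * R)).

(** Chains of arbitrarily small step stand in for connecting curves: the parity arguments need only
    finitely many points, with a step small against the distance between two sets. *)
Definition chainable K p q := forall eps : R, 0 < eps ->
  exists s, [/\ path (fun a b => `|b - a| < eps) p s, last p s = q &
                forall a, a \in p :: s -> K a].

(** The set of differences is compact and misses zero. *)
Lemma compact_apart K L : compact K -> compact L ->
    (forall a b, K a -> L b -> a <> b) ->
  exists2 delta : R, 0 < delta & forall a b, K a -> L b -> delta <= `|a - b|.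
Proof.
move=> cK cL KL; pose f (ab : (R * R) * (R * R)) := ab.1 - ab.2.
have cf : compact (f @` (K `*` L)).
  apply: continuous_compact; last exact: compact_setX.
  apply: continuous_subspaceT => ab.
  by apply: cvgB; [apply: cvg_fst | apply: cvg_snd].
have /closed_openC oD := compact_closed (@norm_hausdorff _ _) cf.
have nf0 : (~` (f @` (K `*` L))) 0.
  by case=> -[a b] [/= Ka Lb] /eqP; rewrite subr_eq0 => /eqP; apply: KL.
have /nbhs_normP[delta /= d0 H] := open_nbhs_nbhs (conj oD nf0).
exists delta => // a b Ka Lb; rewrite leNgt; apply/negP => lt.
by apply: (H (a - b)); [rewrite /= sub0r normrN | exists (a, b)].
Qed.

(** With [m] the sup norm of [w], one coordinate of [h] exceeds [2 * m] in absolute value and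
    outweighs the other one, whose contribution is at least [- m ^+ 2 / 4]. *)
Lemma dotp_near h w : `|w| * 2 < `|h| -> 0 < dotp h (h + w).
Proof.
rewrite !prod_normE /dotp /= => lt.
have [w1 w2] : `|w.1| <= Num.max `|w.1| `|w.2| /\ `|w.2| <= Num.max `|w.1| `|w.2|.
  by rewrite !le_max !lexx orbT.
set m := Num.max `|w.1| `|w.2| in lt w1 w2.
have m0 : 0 <= m by apply: le_trans w1.
have H1 : - (`|h.1| * m) <= h.1 * w.1.
  rewrite lerNl -mulrN (le_trans (ler_norm _)) // normrM normrN.
  exact: ler_wpM2l.
have H2 : - (`|h.2| * m) <= h.2 * w.2.
  rewrite lerNl -mulrN (le_trans (ler_norm _)) // normrM normrN.
  exact: ler_wpM2l.
rewrite !mulrDr -!expr2 -(real_normK (num_real h.1)) -(real_normK (num_real h.2)).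
have aux (a b : R) : 0 <= a -> 0 <= b -> m * 2 < a ->
    0 < a ^+ 2 - a * m + (b ^+ 2 - b * m).
  move=> a0 b0 ma; have a_gt0 : 0 < a by lra.
  have := sqr_ge0 (b - m / 2); have := mulr_gt0 a_gt0 (_ : 0 < a - m * 2).
  by rewrite subr_gt0 => /(_ ma); have := mulr_ge0 m0 (_ : 0 <= a - m * 2); nra.
have := normr_ge0 h.1; have := normr_ge0 h.2 => b0 a0.
by move: lt; rewrite lt_max => /orP[] lt;
  [have := aux _ _ a0 b0 lt | have := aux _ _ b0 a0 lt]; lra.
Qed.

(** The direction is [p - z] itself: the other differences deviate from it by less than [2 * eps],
    which is at most half its norm. *)
Lemma halfplane4_near (delta eps : R) p q z z' : 4 * eps <= delta ->
    delta <= `|p - z| -> `|q - p| < eps -> `|z' - z| < eps ->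
  halfplane4 (p - z) (q - z) (p - z') (q - z').
Proof.
move=> de pz qp zz; have eps0 : 0 < eps by apply: le_lt_trans qp.
exists (p - z).
have H w : `|w| < 2 * eps -> 0 < dotp (p - z) (p - z + w).
  by move=> lt; apply: dotp_near; lra.
split.
- by rewrite -[X in dotp _ X]addr0 H // normr0 mulr_gt0.
- have -> : q - z = p - z + (q - p) by rewrite addrAC [p + _]addrC subrK.
  by apply: H; lra.
- have -> : p - z' = p - z - (z' - z) by rewrite opprB addrA subrK.
  by apply: H; rewrite normrN; lra.
have -> : q - z' = p - z + ((q - p) - (z' - z)).
  by rewrite opprB addrACA [p + _]addrC subrK addKr.
by apply: H; apply: le_lt_trans (ler_normB _ _) _; lra.
Qed.

Lemma chain_sum_apart d (delta eps : R) K L p s z t : 4 * eps <= delta ->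
    (forall a b, K a -> L b -> delta <= `|a - b|) ->
    path (fun a b => `|b - a| < eps) p s -> (forall a, a \in p :: s -> K a) ->
    path (fun a b => `|b - a| < eps) z t -> (forall a, a \in z :: t -> L a) ->
  chain_sum (seen_from d z) p s (+) chain_sum (seen_from d (last z t)) p s =
  chain_sum (fun z z' => crosses d (p - z) (p - z')) z t (+)
  chain_sum (fun z z' => crosses d (last p s - z) (last p s - z')) z t.
Proof.
move=> de KL ps Ks pt Lt; apply: chain_sum_rect.
apply: (@sub_in_path _ (fun a => `[< L a >]) _ _ _ z t) pt; last first.
  by apply/allP => a /Lt La; apply/asboolP.
move=> a b; rewrite !inE => La Lb ab.
apply: (@sub_in_path _ (fun a => `[< K a >]) _ _ _ p s) ps; last first.
  by apply/allP => c /Ks Kc; apply/asboolP.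
move=> c c'; rewrite !inE => Kc Kc' cc'.
exact: (halfplane4_near de (KL _ _ Kc La) cc' ab).
Qed.

(** Here [z] and [z'] may be far apart compared with [eps]. Both are close to [O], so the direction
    [a - O] serves a whole cell, with deviations below [s / 4 + s / 8]. *)
Lemma chain_sum_near d (eps s : R) K O z z' p t : 4 * eps <= s ->
    (forall a, K a -> s <= `|a - O|) -> `|z - O| < s / 8 -> `|z' - O| < s / 8 ->
    path (fun a b => `|b - a| < eps) p t -> (forall a, a \in p :: t -> K a) ->
  chain_sum (seen_from d z) p t (+) chain_sum (seen_from d z') p t =
  crosses d (p - z) (p - z') (+) crosses d (last p t - z) (last p t - z').
Proof.
move=> es sP zO z'O pt Kt; apply: chain_sum_strip.
apply: (@sub_in_path _ (fun a => `[< K a >]) _ _ _ p t) pt; last first.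
  by apply/allP => a /Kt Ka; apply/asboolP.
move=> a b; rewrite !inE => Ka Kb ab; exists (a - O).
have near w : `|w| < 3 * s / 8 -> 0 < dotp (a - O) (a - O + w).
  by move=> lt; apply: dotp_near; have := sP a Ka; have := normr_ge0 w; lra.
have E c y : c - y = a - O + ((c - a) - (y - O)).
  by rewrite opprB addrACA [a + _]addrC subrK addKr.
have H c y : `|c - a| < eps -> `|y - O| < s / 8 -> 0 < dotp (a - O) (c - y).
  move=> ca yO; rewrite E; apply: near; apply: le_lt_trans (ler_normB _ _) _.
  by lra.
by split; apply: H; rewrite ?subrr ?normr0 //; apply: le_lt_trans ab.
Qed.

(** Twice this product is the squared distance from [p] to [z] plus [r2 - sqdist z O]. *)
Lemma circle_halfplane (r2 : R) O p z :
    sqdist p O = r2 -> sqdist z O <= r2 -> z <> p -> 0 < dotp (p - O) (p - z).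
Proof.
rewrite /sqdist /dotp /= => pO zO zp.
have : 0 < (p.1 - z.1) ^+ 2 + (p.2 - z.2) ^+ 2.
  rewrite lt_def addr_ge0 ?sqr_ge0 // andbT; apply/negP.
  rewrite paddr_eq0 ?sqr_ge0 // !sqrf_eq0 !subr_eq0 => /andP[/eqP e1 /eqP e2].
  by apply: zp; rewrite [z]surjective_pairing [p]surjective_pairing e1 e2.
by nra.
Qed.

(** * Parities of a closed chain made of [eta], inside the disc, and [rho], away from its centre *)

Section Core.
Variables (r2 : R) (O p1 p2 : R * R) (eta rho : set (R * R)).
Hypotheses (p1O : sqdist p1 O = r2) (p2O : sqdist p2 O = r2).
Hypotheses (eta_disc : forall a, eta a -> sqdist a O <= r2).
Hypotheses (c_eta : compact eta) (c_rho : compact rho) (rhoO : ~ rho O).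
Hypotheses (ch_eta : chainable eta p1 p2) (ch_rho : chainable rho p2 p1).

(* An arc that starts at [O], goes to [q] within the disc and then on to a point
   [f] which a line separates from [eta] and [rho]; its start is cut off
   because it belongs to [eta]. *)
Definition escape q f := exists h,
  [/\ (forall a, eta a -> 0 < dotp h (a - f)), (forall a, rho a -> 0 < dotp h (a - f)) &
   forall s : R, 0 < s -> exists z K L,
    [/\ `|z - O| < s,
     [/\ compact K, chainable K z q, forall a b, eta a -> K b -> a <> b &
         forall a, K a -> sqdist a O <= r2] &
     [/\ compact L, chainable L z f, forall a b, eta a -> L b -> a <> b &
         forall a b, rho a -> L b -> a <> b]]].

Lemma chainable_mem K p q : chainable K p q -> K p /\ K q.
Proof.
move=> /(_ 1 ltr01)[s [_ <- sK]].
by split; apply: sK; rewrite ?mem_head ?mem_last.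
Qed.

(** The ray is parallel to the chord, so both ends of [eta] are on the same side as seen from any
    point. *)
Let d := p1 - p2.

Lemma side_sub_ends q : side d (p1 - q) = side d (p2 - q).
Proof. by rewrite /side; congr (0 <= _); rewrite /detp /d /=; ring. Qed.

(* All of the disc but [q] lies in the open half-plane bounded by the tangent at
   [q]. *)
Lemma chain_sum_circle q se : sqdist q O = r2 -> (forall a, eta a -> a <> q) ->
    (forall a, a \in p1 :: se -> eta a) -> last p1 se = p2 ->
  chain_sum (seen_from d q) p1 se = false.
Proof.
move=> qO eq Kse lse.
have -> := @chain_sum_half _ d (O - q) (fun a => a - q) p1 se.
  by rewrite lse side_sub_ends addbb andbF.
move=> a /Kse ea; have := circle_halfplane qO (eta_disc ea) (eq a ea).
by rewrite /dotp /=; lra.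
Qed.

(** Seen from [p1] and from [p2] the disc lies in half-planes, and only the one at [p1] shows the
    ray. So a point moving in the disc off [eta] changes the parity of [eta] through the end [p1]
    alone. *)
Lemma chain_sum_disc K z k : p1 <> p2 -> (forall a, K a -> sqdist a O <= r2) ->
    (forall a b, eta a -> K b -> a <> b) -> (forall a, a \in z :: k -> K a) ->
  chain_sum (fun z z' => crosses d (p1 - z) (p1 - z')) z k =
    side d (p1 - z) (+) side d (p1 - last z k) /\
  chain_sum (fun z z' => crosses d (p2 - z) (p2 - z')) z k = false.
Proof.
move=> p12 Kd eK Kk; have [etap1 etap2] := chainable_mem ch_eta.
have d1 : 0 < dotp (p1 - O) d.
  by apply: (circle_halfplane p1O); [rewrite p2O | apply/nesym].
have d2 : (0 < dotp (p2 - O) d) = false.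
  have : 0 < dotp (p2 - O) (p2 - p1) by apply: (circle_halfplane p2O); rewrite ?p1O.
  by rewrite /dotp /d /=; lra.
split.
  rewrite (@chain_sum_half _ d (p1 - O) (fun z => p1 - z)) ?d1 // => a /Kk Ka.
  by apply: (circle_halfplane p1O); [apply: Kd | apply/nesym/eK].
rewrite (@chain_sum_half _ d (p2 - O) (fun z => p2 - z)) ?d2 // => a /Kk Ka.
by apply: (circle_halfplane p2O); [apply: Kd | apply/nesym/eK].
Qed.

(** The parities of [eta] and [rho] agree at the far points and change equally along [L1] and [L2],
    so they agree at [z1] and at [z2]. That of [eta] vanishes at [q1] and [q2]. Comparing the moves
    within the disc, [p1 - q1] and [p1 - q2] would be on the same side, but the cyclic order puts
    [q1] and [q2] on opposite sides of the chord. *)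
Lemma no_alternation q1 q2 f1 f2 : sqdist q1 O = r2 -> sqdist q2 O = r2 ->
  escape q1 f1 -> escape q2 f2 -> ccw p1 q1 p2 -> ccw p1 p2 q2 -> False.
Proof.
move=> q1O q2O [h1 [eta_f1 rho_f1 esc1]] [h2 [eta_f2 rho_f2 esc2]] ccw1 ccw2.
have [s s0 sP] : exists2 s : R, 0 < s & forall a, rho a -> s <= `|a - O|.
  have cO : compact [set O] by apply: compact_set1.
  have [|s s0 sP] := compact_apart c_rho cO.
    by move=> a b ra /= -> aO; apply: rhoO; rewrite -aO.
  by exists s => // a ra; apply: sP.
have s8 : 0 < s / 8 by rewrite divr_gt0.
have [z1 [K1 [L1 [z1O [cK1 chK1 eK1 K1d] [cL1 chL1 eL1 rL1]]]]] := esc1 _ s8.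
have [z2 [K2 [L2 [z2O [cK2 chK2 eK2 K2d] [cL2 chL2 eL2 rL2]]]]] := esc2 _ s8.
have [a1 a10 a1P] := compact_apart c_eta cK1 eK1.
have [a2 a20 a2P] := compact_apart c_eta cK2 eK2.
have [b1 b10 b1P] := compact_apart c_eta cL1 eL1.
have [b2 b20 b2P] := compact_apart c_eta cL2 eL2.
have [c1 c10 c1P] := compact_apart c_rho cL1 rL1.
have [c2 c20 c2P] := compact_apart c_rho cL2 rL2.
have [eps eps0 epsP] : exists2 eps : R, 0 < eps &
    [/\ 4 * eps <= a1 /\ 4 * eps <= a2, 4 * eps <= b1 /\ 4 * eps <= b2,
        4 * eps <= c1 /\ 4 * eps <= c2 & 4 * eps <= s].
  exists (Num.min (Num.min (Num.min a1 a2) (Num.min b1 b2))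
           (Num.min (Num.min c1 c2) s) / 4).
    by rewrite divr_gt0 // !lt_min a10 a20 b10 b20 c10 c20 s0.
  rewrite mulrC divfK ?pnatr_eq0 //.
  by split; rewrite ?ge_min ?lexx ?orbT //; split; rewrite !ge_min !lexx ?orbT.
have {epsP} [[ea1 ea2] [eb1 eb2] [ec1 ec2] es] := epsP.
have [se [pse lse Kse]] := ch_eta eps0; have [sr [psr lsr Ksr]] := ch_rho eps0.
have [k1 [pk1 lk1 Kk1]] := chK1 _ eps0; have [k2 [pk2 lk2 Kk2]] := chK2 _ eps0.
have [l1 [pl1 ll1 Kl1]] := chL1 _ eps0; have [l2 [pl2 ll2 Kl2]] := chL2 _ eps0.
have Re1 := chain_sum_apart d eb1 b1P pse Kse pl1 Kl1.
have Re2 := chain_sum_apart d eb2 b2P pse Kse pl2 Kl2.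
have Rr1 := chain_sum_apart d ec1 c1P psr Ksr pl1 Kl1.
have Rr2 := chain_sum_apart d ec2 c2P psr Ksr pl2 Kl2.
have Rk1 := chain_sum_apart d ea1 a1P pse Kse pk1 Kk1.
have Rk2 := chain_sum_apart d ea2 a2P pse Kse pk2 Kk2.
have half w w' se' f h (S : set (R * R)) : (forall a, a \in w :: se' -> S a) ->
    last w se' = w' -> (forall a, S a -> 0 < dotp h (a - f)) ->
    chain_sum (seen_from d f) w se' =
    (0 < dotp h d) && (side d (w - f) (+) side d (w' - f)).
  move=> Sse <- H; apply: (@chain_sum_half _ d h (fun a => a - f)) => a /Sse.
  exact: H.
(* Around the far point the closed chain sums to zero. *)
have far f h : (forall a, eta a -> 0 < dotp h (a - f)) ->
    (forall a, rho a -> 0 < dotp h (a - f)) ->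
    chain_sum (seen_from d f) p1 se (+) chain_sum (seen_from d f) p2 sr = false.
  move=> He Hr; rewrite (half _ _ _ _ _ _ Kse lse He) (half _ _ _ _ _ _ Ksr lsr Hr).
  by case: (_ < _); case: (side _ _); case: (side _ _).
have far1 := far _ _ eta_f1 rho_f1; have far2 := far _ _ eta_f2 rho_f2.
(* Moving from [z1] to [z2], both close to [O], does not cross [rho]. *)
have Rr := chain_sum_near d es sP z1O z2O psr Ksr; rewrite lsr in Rr.
have p12 : p1 <> p2.
  by move=> E; move: ccw2; rewrite /ccw E !subrr !mul0r subrr ltxx.
have [q1p1 q1p2] := chain_sum_disc p12 K1d eK1 Kk1.
have q1e := chain_sum_circle q1O (fun a ea => eK1 a _ ea (chainable_mem chK1).2) Kse lse.
have [q2p1 q2p2] := chain_sum_disc p12 K2d eK2 Kk2.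
have q2e := chain_sum_circle q2O (fun a ea => eK2 a _ ea (chainable_mem chK2).2) Kse lse.
rewrite lk1 lse q1e q1p1 q1p2 lk1 !addbF in Rk1.
rewrite lk2 lse q2e q2p1 q2p2 lk2 !addbF in Rk2.
rewrite ll1 lse in Re1; rewrite ll2 lse in Re2.
rewrite ll1 lsr in Rr1; rewrite ll2 lsr in Rr2.
have parity (x y u v a b : bool) : x (+) y = a (+) b -> u (+) v = b (+) a ->
    y (+) v = false -> x = u.
  by case: x y u v a b => [] [] [] [] [] [].
have EG1 := parity _ _ _ _ _ _ Re1 Rr1 far1.
have EG2 := parity _ _ _ _ _ _ Re2 Rr2 far2.
(* The single step from [z1] to [z2] is treated as a chain in the union of [K1] and [K2]. *)
have [z1p1 z1p2] : chain_sum (fun z z' => crosses d (p1 - z) (p1 - z')) z1 [:: z2] =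
      side d (p1 - z1) (+) side d (p1 - z2) /\
    chain_sum (fun z z' => crosses d (p2 - z) (p2 - z')) z1 [:: z2] = false.
  apply: (@chain_sum_disc (K1 `|` K2)) => //.
  - by move=> a [/K1d|/K2d].
  - by move=> a b ea [Kb|Kb]; [apply: eK1 | apply: eK2].
  move=> a; rewrite !inE => /orP[] /eqP->; [left | right].
    exact: (chainable_mem chK1).1.
  exact: (chainable_mem chK2).1.
rewrite /= addbF in z1p1; rewrite /= addbF in z1p2.
rewrite z1p1 z1p2 -EG1 -EG2 in Rr.
have sq1 : side d (p1 - q1) = false.
  apply/negbTE; rewrite /side -ltNge; move: ccw1.
  by rewrite /ccw /detp /d /=; lra.
have sq2 : side d (p1 - q2) = true.
  rewrite /side; move: ccw2; rewrite /ccw /detp /d /=; lra.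
move: Rr Rk1 Rk2; rewrite sq1 sq2.
clear; do 2![case: (chain_sum _ _ _)]; do 2![case: (side _ _)] => //.
Qed.



End Core.
End Chains.

(** * Connectedness by chains, in particular along arcs *)

Section Chainable.
Local Open Scope classical_set_scope.
Local Open Scope ring_scope.
Variable R : realType.
Implicit Types (K L : set (R * R)) (p q : R * R).

Lemma chainable_sub K L p q : K `<=` L -> chainable K p q -> chainable L p q.
Proof. by move=> KL ch eps /ch[s [ps ls Ks]]; exists s; split=> // a /Ks/KL. Qed.

Lemma chainable_refl K p : K p -> chainable K p p.
Proof. by move=> Kp eps _; exists [::]; split=> // a; rewrite inE => /eqP ->. Qed.

Lemma chainable_trans K p q r :
  chainable K p q -> chainable K q r -> chainable K p r.
Proof.
move=> ch1 ch2 eps e0; have [s [ps ls Ks]] := ch1 _ e0.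
have [t [pt lt Kt]] := ch2 _ e0; exists (s ++ t); split.
- by rewrite cat_path ps ls pt.
- by rewrite last_cat ls.
move=> a; rewrite -cat_cons mem_cat => /orP[/Ks//|at_].
by apply: Kt; rewrite inE at_ orbT.
Qed.

Lemma chainable_sym K p q : chainable K p q -> chainable K q p.
Proof.
move=> ch eps e0; have [s [ps ls Ks]] := ch _ e0.
exists (rev (belast p s)); split.
- rewrite -ls rev_path; apply: sub_path ps => a b /=; by rewrite distrC.
- by move: ls; case: (s) => //= b s' _; rewrite rev_cons last_rcons.
move=> a; rewrite -ls -rev_rcons mem_rev -lastI; exact: Ks.
Qed.

Lemma within_dist (f : R -> R * R) (a b s eps : R) :
    {within `[a, b], continuous f} -> s \in `[a, b] -> 0 < eps ->
  exists2 delta : R, 0 < delta &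
    forall t, t \in `[a, b] -> `|t - s| < delta -> `|f t - f s| < eps.
Proof.
move=> /subspace_continuousP cf sab e0; have /cf cfs : `[a, b]%classic s by [].
have /cvgrPdist_lt/(_ _ e0) := cfs.
rewrite near_withinE => /nbhs_normP[delta /= d0 H].
exists delta => // t tab ts; rewrite distrC; apply: H => //=.
by rewrite distrC.
Qed.

(** The parameters reached by chains of step below [eps] contain their supremum, and continuity
    would push beyond it if it were less than [b]. *)
Lemma chainable_arc (f : R -> R * R) (a b : R) : a <= b ->
  {within `[a, b], continuous f} -> chainable (f @` `[a, b]) (f a) (f b).
Proof.
move=> ab cf eps e0.
pose S := [set t | t \in `[a, b] /\ exists s, [/\ path (fun p q => `|q - p| < eps) (f a) s,
  last (f a) s = f t & forall c, c \in f a :: s -> (f @` `[a, b]) c]].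
have aab : a \in `[a, b] by rewrite in_itv /= lexx.
have Sa : S a.
  split=> //; exists [::]; split=> // c; rewrite inE => /eqP ->.
  by exists a.
have step t t' : S t -> t' \in `[a, b] -> `|f t' - f t| < eps -> S t'.
  move=> [tab [s [ps ls Ks]]] t'ab lt; split=> //.
  exists (rcons s (f t')); split.
  - by rewrite rcons_path ps ls.
  - by rewrite last_rcons.
  move=> c; rewrite -rcons_cons mem_rcons inE => /orP[/eqP->|/Ks//].
  by exists t'.
have ubS : ubound S b by move=> t [+ _]; rewrite in_itv => /andP[].
have hS : has_sup S by split; [exists a | exists b].
pose s := sup S.
have as_ : a <= s by apply: sup_upper_bound.
have sb : s <= b by apply: ge_sup; [exists a |].
have sab : s \in `[a, b] by rewrite in_itv /= as_ sb.
have eps2 : 0 < eps / 2 by rewrite divr_gt0.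
have [delta d0 H] := within_dist cf sab eps2.
have [t St] := sup_adherent d0 hS; rewrite -/s => ts.
have tab : t \in `[a, b] by case: St.
have tles : t <= s by apply: sup_upper_bound.
have e2 : eps / 2 < eps by lra.
have Ss : S s.
  apply: (step t) => //; rewrite distrC; apply: lt_trans e2; apply: H => //.
  by rewrite distrC ger0_norm; lra.
suff sbE : s = b by have [_ [u [pu lu Ku]]] := Ss; exists u; split; rewrite // lu sbE.
apply/eqP; rewrite eq_le sb leNgt; apply/negP => lt_sb.
pose s' := Num.min (s + delta / 2) b.
have s's : s < s' by rewrite lt_min lt_sb andbT ltrDl divr_gt0.
have s'b : s' <= b by rewrite ge_min lexx orbT.
have s'd : s' <= s + delta / 2 by rewrite ge_min lexx.
have s'ab : s' \in `[a, b] by rewrite in_itv /= s'b andbT; lra.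
have : S s'.
  apply: (step s) => //; apply: lt_trans e2; apply: H => //.
  by rewrite ger0_norm; lra.
by move/(sup_upper_bound hS); rewrite leNgt s's.
Qed.


End Chainable.

(** * Paths in an embedded graph *)

Section Drawing.
Local Open Scope classical_set_scope.
Local Open Scope ring_scope.
Variables (R : realType) (V : choiceType) (e : rel V) (G : planar_embedding R e).
Hypothesis irr_e : irreflexive e.
Implicit Types (x y z u v w : V) (S : seq V).

Definition subarc x y (a b : R) : set (R * R) := edge_arc G x y @` `[a, b].

(** Vertices are included separately, since a path of length zero has no edge to draw. *)
Definition drawing S : set (R * R) := [set a |
  (exists2 w, w \in S & a = pos G w) \/
  (exists u v t, [/\ u \in S, v \in S, e u v, t \in `[0, 1] & a = edge_arc G u v t])].

Lemma subarc_continuous x y (a b : R) : e x y -> 0 <= a -> b <= 1 ->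
  {within `[a, b], continuous (edge_arc G x y)}.
Proof.
move=> exy a0 b1.
apply: (continuous_subspaceW _ (arc_continuous (p := G) exy)).
move=> t /=; rewrite !in_itv /= => /andP[at_ tb]; apply/andP; split; lra.
Qed.

Lemma subarc_compact x y (a b : R) : e x y -> 0 <= a -> b <= 1 ->
  compact (subarc x y a b).
Proof.
move=> exy a0 b1; apply: continuous_compact; last exact: segment_compact.
exact: subarc_continuous.
Qed.

Lemma subarc_chainable x y (a b : R) : e x y -> 0 <= a -> a <= b -> b <= 1 ->
  chainable (subarc x y a b) (edge_arc G x y a) (edge_arc G x y b).
Proof. by move=> exy a0 ab b1; apply: chainable_arc => //; apply: subarc_continuous. Qed.

Lemma itv01P (t : R) : t \in `[0, 1] -> [\/ t = 0, t = 1 | t \in `]0, 1[].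
Proof.
rewrite in_itv /= => /andP[t0 t1].
have [->|n0] := eqVneq t 0; first by constructor 1.
have [->|n1] := eqVneq t 1; first by constructor 2.
by constructor 3; rewrite in_itv /= !lt_def t0 t1 n0 eq_sym n1.
Qed.

Lemma arc_vertex u v w (t : R) : e u v -> t \in `[0, 1] ->
  edge_arc G u v t = pos G w -> (t = 0 /\ w = u) \/ (t = 1 /\ w = v).
Proof.
move=> euv /itv01P[->|->|t01] E.
- by left; split=> //; apply: (@pos_inj _ _ _ G); rewrite -E arc_start.
- by right; split=> //; apply: (@pos_inj _ _ _ G); rewrite -E arc_end.
by have := arc_avoids_vertices euv t01 E.
Qed.

Lemma arcs_meet u v u' v' (t t' : R) : e u v -> e u' v' ->
    t \in `[0, 1] -> t' \in `[0, 1] -> edge_arc G u v t = edge_arc G u' v' t' ->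
  exists2 w, w \in [:: u; v] & w \in [:: u'; v'].
Proof.
move=> euv euv' t01 t01' E.
have mem w : edge_arc G u' v' t' = pos G w -> w \in [:: u; v] ->
    exists2 w, w \in [:: u; v] & w \in [:: u'; v'].
  move=> /(arc_vertex euv' t01')[] [_ ->] ?.
    by exists u' => //; rewrite mem_head.
  by exists v' => //; rewrite !inE eqxx orbT.
have [t0|t1|ti] := itv01P t01.
- by apply: (mem u); rewrite ?mem_head // -E t0 arc_start.
- by apply: (mem v); rewrite ?inE ?eqxx ?orbT // -E t1 arc_end.
have [t0|t1|ti'] := itv01P t01'.
- by have [] := @arc_avoids_vertices _ _ _ G _ _ u' _ euv ti; rewrite E t0 arc_start.
- by have [] := @arc_avoids_vertices _ _ _ G _ _ v' _ euv ti; rewrite E t1 arc_end.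
have [[-> ->]|[-> ->]] := arc_disjoint euv euv' ti ti' E.
  by exists u'; rewrite mem_head.
by exists u'; rewrite !inE eqxx ?orbT.
Qed.

(** A common point of two closed arcs forces a common end vertex, by [arcs_meet]. *)
Lemma drawing_disjoint S S' a : (forall v, v \in S -> v \notin S') ->
  drawing S a -> ~ drawing S' a.
Proof.
move=> SS' [[w wS ->]|[u [v [t [uS vS euv t01 ->]]]]].
  case=> [[w' wS' /pos_inj E]|[u' [v' [t' [uS' vS' euv' t01' /esym E]]]]].
    by have := SS' w wS; rewrite E wS'.
  have [[_ E']|[_ E']] := arc_vertex euv' t01' E; have := SS' w wS;
    by rewrite E' ?uS' ?vS'.
case=> [[w' wS' E]|[u' [v' [t' [uS' vS' euv' t01' E]]]]].
  have [[_ E']|[_ E']] := arc_vertex euv t01 E.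
    by have := SS' u uS; rewrite -E' wS'.
  by have := SS' v vS; rewrite -E' wS'.
have [w w1 w2] := arcs_meet euv euv' t01 t01' E.
have wS : w \in S by move: w1; rewrite !inE => /orP[] /eqP->.
have := SS' w wS; apply/negP; rewrite negbK.
by move: w2; rewrite !inE => /orP[] /eqP->.
Qed.

Lemma arcs_meet_start x y b (t t' : R) : e x y -> e x b -> y != b ->
    t \in `[0, 1] -> t' \in `[0, 1] -> edge_arc G x y t = edge_arc G x b t' ->
  t = 0.
Proof.
move=> exy exb yb t01 t01' E.
have xy : x <> y by move=> xy; move: exy; rewrite xy irr_e.
have [//|t1|ti] := itv01P t01.
  move: E; rewrite t1 arc_end // => /esym/(arc_vertex exb t01')[] [_ yE].
    by case: xy.
  by rewrite yE eqxx in yb.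
have [t0|t1|ti'] := itv01P t01'.
- by have [] := @arc_avoids_vertices _ _ _ G _ _ x _ exy ti; rewrite E t0 arc_start.
- by have [] := @arc_avoids_vertices _ _ _ G _ _ b _ exy ti; rewrite E t1 arc_end.
have [[_ yE]|[_ /esym//]] := arc_disjoint exy exb ti ti' E.
by rewrite yE eqxx in yb.
Qed.

Lemma drawing_path u p : path e u p -> exists K,
  [/\ compact K, K `<=` drawing (u :: p) & chainable K (pos G u) (pos G (last u p))].
Proof.
elim: p u => [|v p IHp] u /=.
  move=> _; exists [set pos G u]; split; first exact: compact_set1.
    by move=> a /= ->; left; exists u; rewrite // mem_head.
  exact: chainable_refl.
case/andP=> euv /IHp[K [cK Kp chK]]; exists (subarc u v 0 1 `|` K); split.
- by apply: compactU => //; apply: subarc_compact.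
- move=> a [[t t01 <-]|/Kp[[w wS ->]|[u' [v' [t [uS vS euv' t01 ->]]]]]].
  + by right; exists u, v, t; rewrite !inE !eqxx ?orbT.
  + by left; exists w; rewrite // inE wS orbT.
  by right; exists u', v', t; rewrite ![_ \in u :: _]inE uS vS !orbT.
apply: (@chainable_trans _ _ _ (pos G v)).
  apply: (@chainable_sub _ (subarc u v 0 1)); first exact: subsetUl.
  by rewrite -(arc_start G euv) -(arc_end G euv); apply: subarc_chainable.
by apply: chainable_sub chK; apply: subsetUr.
Qed.

Lemma first_exit_unique (r : R) x y p q :
  first_exit G r x y p -> first_exit G r x y q -> p = q.
Proof.
move=> [t [t01 tp pr tlt]] [t' [t01' tq qr tlt']].
have [lt|lt|E] := ltgtP t t'; last by rewrite -tp -tq E.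
  have := tlt' t; rewrite in_itv /= lt tp pr ltxx => H.
  by move: t01; rewrite in_itv /= => /andP[t0 _]; rewrite t0 in H; have := H isT.
have := tlt t'; rewrite in_itv /= lt tq qr ltxx => H.
by move: t01'; rewrite in_itv /= => /andP[t0 _]; rewrite t0 in H; have := H isT.
Qed.


Lemma first_exit_gt0 (r t : R) x y : 0 < r -> e x y -> 0 <= t ->
  sqdist (edge_arc G x y t) (pos G x) = r ^+ 2 -> 0 < t.
Proof.
move=> r0 exy t0 E; rewrite lt_def t0 andbT; apply: contra_eq_neq E => ->.
by rewrite arc_start // /sqdist !subrr !expr0n addr0 lt_eqF // exprn_gt0.
Qed.

Lemma first_exit_le (r t : R) x y :
    sqdist (edge_arc G x y t) (pos G x) = r ^+ 2 ->
    (forall t', t' \in `[0, t[ -> sqdist (edge_arc G x y t') (pos G x) < r ^+ 2) ->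
  forall a, subarc x y 0 t a -> sqdist a (pos G x) <= r ^+ 2.
Proof.
move=> E lt a [u /= + <-]; rewrite in_itv /= => /andP[u0].
rewrite le_eqVlt => /orP[/eqP->|ut]; first by rewrite E.
by apply/ltW/lt; rewrite in_itv /= u0.
Qed.

Section Alternation.
Variables (x b1 b2 : V) (cs : seq V).
Hypotheses (exb1 : e x b1) (exb2 : e x b2) (csP : path e b1 cs) (csl : last b1 cs = b2).
Hypothesis (xcs : x \notin b1 :: cs).
Let O := pos G x.
Let C := b1 :: cs.
Let cycle_drawing := subarc x b1 0 1 `|` subarc x b2 0 1 `|` drawing C.

Lemma arc_off_cycle y (t : R) : e x y -> y \notin C -> t \in `]0, 1] ->
  ~ cycle_drawing (edge_arc G x y t).
Proof.
move=> exy yC; rewrite in_itv /= => /andP[t0 t1].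
have t01 : t \in `[0, 1] by rewrite in_itv /= ltW.
have aux b : b \in C -> e x b -> ~ subarc x b 0 1 (edge_arc G x y t).
  move=> bC exb [t' t01' /esym E].
  have yb : y != b by apply: contraNneq yC => ->.
  by have := arcs_meet_start exy exb yb t01 t01' E; move: t0 => /[swap] ->; rewrite ltxx.
case=> [[|]|]; first by apply: aux; rewrite ?mem_head.
  by apply: aux; rewrite // -csl mem_last.
have E : drawing [:: x; y] (edge_arc G x y t).
  by right; exists x, y, t; rewrite !inE !eqxx orbT.
by apply: (drawing_disjoint _ E) => v; rewrite !inE => /orP[] /eqP->.
Qed.

Lemma drawing_off_cycle S a : x \notin S -> (forall v, v \in S -> v \notin C) ->
  drawing S a -> ~ cycle_drawing a.
Proof.
move=> xS SC dS; have aux b : b \in C -> e x b -> ~ subarc x b 0 1 a.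
  move=> bC exb [t t01 E].
  have dxb : drawing [:: x; b] a.
    by right; exists x, b, t; rewrite !inE !eqxx orbT.
  apply: (drawing_disjoint _ dxb dS) => v; rewrite !inE => /orP[] /eqP-> //.
  by apply/negP => /SC; rewrite bC.
case=> [[|]|]; first by apply: aux; rewrite ?mem_head.
  by apply: aux; rewrite // -csl mem_last.
exact: drawing_disjoint dS.
Qed.

(** Some coordinate of [f] exceeds [M] in absolute value, so a line parallel to an axis
    separates. *)
Lemma far_halfplane (f : R * R) (M : R) (K : set (R * R)) :
    (forall a, K a -> `|a| <= M) -> M < `|f| ->
  exists h, forall a, K a -> 0 < dotp h (a - f).
Proof.
move=> KM; rewrite prod_normE lt_max => /orP[] lt.
  exists (- Num.sg f.1, 0) => a /KM; rewrite prod_normE ge_max => /andP[a1 _].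
  rewrite /dotp /= mul0r addr0 mulNr mulrBr -normrEsg opprB subr_gt0.
  apply: le_lt_trans lt; apply: le_trans a1; apply: le_trans (ler_norm _) _.
  by rewrite normrM normr_sg ler_piMl // lern1 leq_b1.
exists (0, - Num.sg f.2) => a /KM; rewrite prod_normE ge_max => /andP[_ a2].
rewrite /dotp /= mul0r add0r mulNr mulrBr -normrEsg opprB subr_gt0.
apply: le_lt_trans lt; apply: le_trans a2; apply: le_trans (ler_norm _) _.
by rewrite normrM normr_sg ler_piMl // lern1 leq_b1.
Qed.

(** [K] follows the arc up to its first exit, [L] the whole arc and then the path. Both drop the
    beginning of the arc, whose start is its only point on the cycle. *)
Lemma escape_path (eta rho : set (R * R)) (M r : R) y q ys :
    eta `<=` cycle_drawing -> rho `<=` cycle_drawing ->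
    (forall a, (eta `|` rho) a -> `|a| <= M) -> 0 < r ->
    e x y -> first_exit G r x y q -> path e y ys -> x \notin y :: ys ->
    (forall v, v \in y :: ys -> v \notin C) -> M < `|pos G (last y ys)| ->
  escape (r ^+ 2) O eta rho q (pos G (last y ys)).
Proof.
move=> etaC rhoC CM r0 exy [t [t01 tq qr tlt]] ysP xys ysC farM.
have [h hP] := far_halfplane CM farM.
exists h; split=> [a ?|a ?|s s0]; [by apply: hP; left|by apply: hP; right|].
move: (t01); rewrite in_itv /= => /andP[t0 t1].
have {}t0 : 0 < t by apply: (first_exit_gt0 r0 exy t0); rewrite tq.
have z01 : 0 \in `[(0 : R), 1] by rewrite in_itv /= lexx ler01.
have [delta d0 near0] := within_dist (arc_continuous (p := G) exy) z01 s0.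
(* At most [t], to stay before the first exit, and below [delta], to be within [s] of the position
   of [x]. *)
pose u := Num.min (delta / 2) t.
have u0 : 0 < u by rewrite lt_min t0 divr_gt0.
have ut : u <= t by rewrite ge_min lexx orbT.
have ud : u <= delta / 2 by rewrite ge_min lexx.
have u1 : u <= 1 by apply: le_trans t1.
have [K [cK Kys chK]] := drawing_path ysP.
have yC : y \notin C by apply: ysC; rewrite mem_head.
have off (v : R) : u <= v -> v <= 1 -> ~ cycle_drawing (edge_arc G x y v).
  by move=> uv v1; apply: arc_off_cycle => //; rewrite in_itv /= v1 (lt_le_trans u0).
have offL a : (subarc x y u 1 `|` K) a -> ~ cycle_drawing a.
  case=> [[v /=]|/Kys dr]; last exact: drawing_off_cycle dr.
  by rewrite in_itv /= => /andP[uv v1] <-; apply: off.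
exists (edge_arc G x y u), (subarc x y u t), (subarc x y u 1 `|` K); split.
- rewrite /O -(arc_start G exy); apply: near0; first by rewrite in_itv /= ltW.
  by rewrite subr0 gtr0_norm //; lra.
- split.
  + by apply: subarc_compact => //; apply: ltW.
  + by rewrite -tq; apply: subarc_chainable => //; apply: ltW.
  + move=> a b /etaC ca [v /=]; rewrite in_itv /= => /andP[uv vt] <- ab.
    by apply: (off v uv (le_trans vt t1)); rewrite -ab.
  move=> a [v /=]; rewrite in_itv /= => /andP[uv vt] va.
  apply: (@first_exit_le r t x y); rewrite ?tq //; exists v => //=.
  by rewrite in_itv /= vt andbT; apply: le_trans uv; apply: ltW.
split.
- by apply: compactU => //; apply: subarc_compact => //; apply: ltW.
- apply: (@chainable_trans _ _ _ (pos G y)).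
    apply: (@chainable_sub _ (subarc x y u 1)); first exact: subsetUl.
    by rewrite -(arc_end G exy); apply: subarc_chainable => //; apply: ltW.
  by apply: chainable_sub chK; apply: subsetUr.
- by move=> a b /etaC ca /offL nb ab; apply: nb; rewrite -ab.
by move=> a b /rhoC ca /offL nb ab; apply: nb; rewrite -ab.
Qed.

(** [M] bounds the cycle alone and so is chosen before the escaping paths. The arcs from [x] to [b1]
    and [b2] are cut where they first reach a small circle: the beginnings form [eta], the rest of
    the cycle forms [rho]. *)
Lemma no_alternating_paths : exists M : R, forall y1 y2 ys1 ys2,
    e x y1 -> e x y2 -> anticlockwise G x b1 y1 b2 -> anticlockwise G x b1 b2 y2 ->
    path e y1 ys1 -> x \notin y1 :: ys1 -> (forall v, v \in y1 :: ys1 -> v \notin C) ->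
    path e y2 ys2 -> x \notin y2 :: ys2 -> (forall v, v \in y2 :: ys2 -> v \notin C) ->
    M < `|pos G (last y1 ys1)| -> M < `|pos G (last y2 ys2)| -> False.
Proof.
have [K [cK KC chK]] := drawing_path csP.
pose arcs := subarc x b1 0 1 `|` subarc x b2 0 1 `|` K.
have /compact_bounded/pinfty_ex_gt0[M M0 arcsM] : compact arcs.
  by apply: compactU => //; apply: compactU; apply: subarc_compact.
exists M => y1 y2 ys1 ys2 exy1 exy2 acw1 acw2 ysP1 xys1 ysC1 ysP2 xys2 ysC2 far1 far2.
have FF : ProperFilter (0 : R)^'+ := at_right_proper_filter (0 : R).
(* One radius at which both cyclic orders can be read off. *)
have [r [[acw1r acw2r] r0]] := @filter_ex _ _ FF _ (@filterI _ _ FF _ _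
  (@filterI _ _ FF _ _ acw1 acw2) (nbhs_right_gt (0 : R))).
have [p1 [q1 [p2 [ex_p1 ex_q1 ex_p2 ccw1]]]] := acw1r.
have [p1' [p2' [q2 [ex_p1' ex_p2' ex_q2 ccw2]]]] := acw2r.
move: ccw2; rewrite -(first_exit_unique ex_p1 ex_p1') -(first_exit_unique ex_p2 ex_p2').
move=> ccw2 {ex_p1' ex_p2' acw1r acw2r acw1 acw2}.
have := ex_p1 => -[t1 [t1_01 tp1 p1r lt1]]; have := ex_p2 => -[t2 [t2_01 tp2 p2r lt2]].
move: t1_01 t2_01; rewrite !in_itv /= => /andP[t1_0 t1_1] /andP[t2_0 t2_1].
have t1_gt0 : 0 < t1 by apply: (first_exit_gt0 r0 exb1 t1_0); rewrite tp1.
have t2_gt0 : 0 < t2 by apply: (first_exit_gt0 r0 exb2 t2_0); rewrite tp2.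
pose eta := subarc x b1 0 t1 `|` subarc x b2 0 t2.
pose rho := subarc x b1 t1 1 `|` subarc x b2 t2 1 `|` K.
have sub_arc b (s t : R) : 0 <= s -> t <= 1 -> subarc x b s t `<=` subarc x b 0 1.
  move=> s0 t_1 a [v /=]; rewrite in_itv /= => /andP[sv vt] <-; exists v => //=.
  by rewrite in_itv /=; apply/andP; split; lra.
have eta_arcs : eta `<=` arcs.
  by move=> a [] /sub_arc H; left; [left | right]; apply: H.
have rho_arcs : rho `<=` arcs.
  by move=> a [[] /sub_arc H|Ka]; 
    [left; left; apply: H => //|left; right; apply: H => //|right].
have arcsC : arcs `<=` cycle_drawing by move=> a [?|/KC ?]; [left | right].
have etarhoM a : (eta `|` rho) a -> `|a| <= M.
  by case=> [/eta_arcs|/rho_arcs]; apply: arcsM.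
have esc y q ys := @escape_path eta rho M r y q ys (subset_trans eta_arcs arcsC)
  (subset_trans rho_arcs arcsC) etarhoM r0.
have b1C : b1 \in C by apply: mem_head.
have b2C : b2 \in C by rewrite -csl mem_last.
have circ y q : first_exit G r x y q -> sqdist q O = r ^+ 2 by case=> t [].
apply: (@no_alternation R (r ^+ 2) O p1 p2 eta rho p1r p2r _ _ _ _ _ _ q1 q2
  (pos G (last y1 ys1)) (pos G (last y2 ys2))) => //.
- by move=> a [] H; [apply: first_exit_le lt1 _ H | apply: first_exit_le lt2 _ H];
  rewrite ?tp1 ?tp2.
- by apply: compactU; apply: subarc_compact.
- by apply: compactU => //; apply: compactU; apply: subarc_compact.
(* An arc from [x] passes through [O] only at parameter zero, which the cuts at [t1] and [t2]
   exclude from [rho]. *)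
- have O_arc b (t v : R) : e x b -> 0 < t -> t <= v -> v <= 1 -> edge_arc G x b v <> O.
    move=> exb t0 tv v1 /(arc_vertex exb)[|[v0 _]|[_ xb]].
    + by rewrite in_itv /= v1 (le_trans (ltW t0) tv).
    + by move: tv; rewrite v0 leNgt t0.
    by move: exb; rewrite -xb irr_e.
  case=> [[] [v /=]|/KC]; last first.
    have dx : drawing [:: x] O by left; exists x; rewrite ?mem_head.
    by apply: (drawing_disjoint _ dx) => v; rewrite inE => /eqP->.
    by rewrite in_itv /= => /andP[tv v1]; apply: O_arc tv v1.
  by rewrite in_itv /= => /andP[tv v1]; apply: O_arc tv v1.
- apply: (@chainable_trans _ _ _ O).
    apply: chainable_sym; apply: (@chainable_sub _ (subarc x b1 0 t1)).
      exact: subsetUl.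
    by rewrite -tp1 /O -(arc_start G exb1); apply: subarc_chainable.
  apply: (@chainable_sub _ (subarc x b2 0 t2)); first exact: subsetUr.
  by rewrite -tp2 /O -(arc_start G exb2); apply: subarc_chainable.
- apply: (@chainable_trans _ _ _ (pos G b2)).
    apply: (@chainable_sub _ (subarc x b2 t2 1)); first by move=> a; left; right.
    by rewrite -tp2 -(arc_end G exb2); apply: subarc_chainable.
  apply: (@chainable_trans _ _ _ (pos G b1)).
    apply: chainable_sym; rewrite -csl; apply: chainable_sub chK; exact: subsetUr.
  apply: chainable_sym; apply: (@chainable_sub _ (subarc x b1 t1 1)).
    by move=> a; left; left.
  by rewrite -tp1 -(arc_end G exb1); apply: subarc_chainable.
- exact: circ ex_q1.
- exact: circ ex_q2.
- exact: esc.
- exact: esc.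
Qed.

End Alternation.

End Drawing.

(** * Cyclic order of the rotors and choice of an initial rotor *)

Section CyclicOrder.
Local Open Scope classical_set_scope.
Variables (V : choiceType) (e : rel V) (rot : V -> V -> V).
Hypothesis rotM : rotor_mechanism e rot.
Variables (x : V) (N : seq V).
Hypotheses (uN : uniq N) (memN : forall z, (z \in N) = e x z).

Lemma iter_rot_inj y i j : e x y -> i < size N -> j < size N ->
  iter i (rot x) y = iter j (rot x) y -> i = j.
Proof.
move=> exy ltiN ltjN E; have := uniq_traject_rot rotM uN memN exy.
move/uniqP => /(_ y i j); rewrite !inE !size_traject !nth_traject //.
exact.
Qed.

Section Consecutive.
Variable acw : V -> V -> V -> Prop.
Hypothesis acw_cyc : forall a b c, acw a b c -> acw b c a.
Hypothesis acw_trans : forall a b c d, acw a b c -> acw a c d -> acw a b d.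
Hypothesis acw_rot : forall y z, e x y -> e x z -> z <> y -> z <> rot x y ->
  acw y (rot x y) z.

(** The relation is abstract so as to serve both senses of rotation. Consecutive iterates are in
    order as seen from [y], and transitivity joins them up. *)
Lemma acw_iter_rot y j k : e x y -> 0 < j < k -> k < size N ->
  acw y (iter j (rot x) y) (iter k (rot x) y).
Proof.
move=> exy /andP[j0 jk].
have consec i : 0 < i -> i.+1 < size N ->
    acw y (iter i (rot x) y) (iter i.+1 (rot x) y).
  move=> i0 iN; apply/acw_cyc/acw_cyc/acw_rot => //; first exact: (rot_edge rotM).
    by move/(@iter_rot_inj y 0 i) => /(_ exy); lia.
  by move/(@iter_rot_inj y 0 i.+1) => /(_ exy); lia.
elim: k jk => // k IHk; rewrite ltnS leq_eqVlt => /orP[/eqP<-|jk] kN.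
  exact: consec.
by apply: acw_trans (consec k _ kN); [apply: IHk => //; apply: ltnW | lia].
Qed.

End Consecutive.

(* Start just after an outer neighbour from which an inner one is reached as fast
   as possible. *)
Lemma rotor_choice (I O : pred V) (y0 : V) : e x y0 -> (forall v, I v -> ~~ O v) ->
    (forall y i j k, e x y -> 0 < i < j -> j < k < size N -> O y ->
      I (iter i (rot x) y) -> O (iter j (rot x) y) -> I (iter k (rot x) y) ->
      False) ->
  exists2 y, e x y & forall i j, 0 < i < j -> j <= size N ->
    I (iter j (rot x) y) -> ~~ O (iter i (rot x) y).
Proof.
move=> exy0 IO nopat.
have [[w [z [exw exz Ow Iz]]]|H] :=
  pselect (exists w z, [/\ e x w, e x z, O w & I z]); last first.
  exists y0 => // i j _ _ Ij; apply/negP => Oi; apply: H.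
  by exists (iter i (rot x) y0), (iter j (rot x) y0); split=> //; apply: (rot_edge rotM).
have ext : exists t, `[< exists y, [/\ e x y, O y & I (iter t (rot x) y)] >].
  have [t tz] := (rotM exw).2 z exz; exists t; apply/asboolP; exists w.
  by rewrite tz.
case: (ex_minnP ext) => t /asboolP[y [exy Oy Ity]] tmin.
exists y => // i j /andP[i0 ij] jN Ij; apply/negP => Oi.
have t0 : 0 < t by case: (t) Ity => // /IO; rewrite /= Oy.
have it : t < i.
  rewrite ltnNge leq_eqVlt; apply/negP => /orP[/eqP it|it].
    by move: (IO _ Ity); rewrite -it Oi.
  (* Otherwise iterate [i] would be an outer neighbour closer to the inner one at [t]. *)
  have : t <= t - i; last by lia.
  apply: tmin; apply/asboolP; exists (iter i (rot x) y); split => //.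
    exact: (rot_edge rotM).
  by rewrite -iterD subnK // ltnW.
(* A full turn ends at [y] itself, which is outer. *)
have jltN : j < size N.
  rewrite ltn_neqAle jN andbT; apply/eqP => jE.
  by move: (IO _ Ij); rewrite jE (iter_rot_size rotM uN memN) // Oy.
by apply: (nopat y t i j); rewrite ?t0 ?it ?ij ?jltN.
Qed.

End CyclicOrder.

(** * Cyclic order of the edges in the embedding *)

Section Anticlockwise.
Local Open Scope classical_set_scope.
Local Open Scope ring_scope.
Variables (R : realType) (V : choiceType) (e : rel V) (G : planar_embedding R e).

Lemma anticlockwise_cyc x a b c : anticlockwise G x a b c -> anticlockwise G x b c a.
Proof.
have FF : ProperFilter (0 : R)^'+ := at_right_proper_filter (0 : R).
apply: filterS => r [p [q [s [ep eq es]]]] H; exists q, s, p; split=> //.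
by move: H; rewrite /ccw; lra.
Qed.

(** Seen from [p] the other points lie in an open half-plane by [circle_halfplane]. The identity is
    the linear relation between three plane vectors, paired with [p - O]. *)
Lemma ccw_trans (r2 : R) O p q s t :
    sqdist p O = r2 -> sqdist q O = r2 -> sqdist s O = r2 -> sqdist t O = r2 ->
  ccw p q s -> ccw p s t -> ccw p q t.
Proof.
move=> pO qO sO tO; rewrite /ccw => pqs pst.
have ne u : sqdist u O = r2 -> u <> p -> 0 < dotp (p - O) (p - u).
  by move=> uO; apply: (circle_halfplane pO); rewrite uO.
have hq : 0 < dotp (p - O) (p - q).
  by apply: ne => // E; move: pqs; rewrite E !subrr !mul0r subrr ltxx.
have hs : 0 < dotp (p - O) (p - s).
  by apply: ne => // E; move: pst; rewrite E !subrr !mul0r subrr ltxx.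
have ht : 0 < dotp (p - O) (p - t).
  by apply: ne => // E; move: pst; rewrite E !subrr !mulr0 subrr ltxx.
rewrite -(pmulr_rgt0 _ hs).
have -> : dotp (p - O) (p - s) *
    ((q.1 - p.1) * (t.2 - p.2) - (q.2 - p.2) * (t.1 - p.1)) =
  dotp (p - O) (p - q) * ((s.1 - p.1) * (t.2 - p.2) - (s.2 - p.2) * (t.1 - p.1)) +
  dotp (p - O) (p - t) * ((q.1 - p.1) * (s.2 - p.2) - (q.2 - p.2) * (s.1 - p.1)).
  by rewrite /dotp /=; ring.
by apply: addr_gt0; apply: mulr_gt0.
Qed.

Lemma anticlockwise_trans x a b c d :
  anticlockwise G x a b c -> anticlockwise G x a c d -> anticlockwise G x a b d.
Proof.
have FF : ProperFilter (0 : R)^'+ := at_right_proper_filter (0 : R).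
apply: filterS2 => r [p [q [s [ep eq es H1]]]] [p' [s' [t [ep' es' et H2]]]].
exists p, q, t; split=> //.
move: H2; rewrite -(first_exit_unique ep ep') -(first_exit_unique es es').
have circ y u : first_exit G r x y u -> sqdist u (pos G x) = r ^+ 2.
  by case=> v [].
exact: ccw_trans (circ _ _ ep) (circ _ _ eq) (circ _ _ es) (circ _ _ et) H1.
Qed.

Hypotheses (irr_e : irreflexive e) (sym_e : symmetric e).
Variable rot : V -> V -> V.
Hypothesis rotM : rotor_mechanism e rot.
Hypothesis rotG : forall x, anticlockwise_at G rot x \/ clockwise_at G rot x.

(** In the clockwise case [b1] and [b2] exchange roles and the path between them is reversed. *)
Lemma no_rotor_alternation x (N : seq V) : uniq N ->
    (forall z, (z \in N) = e x z) -> forall b1 cs i j k,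
    let b2 := iter j (rot x) b1 in
    e x b1 -> (0 < i < j)%N -> (j < k < size N)%N -> path e b1 cs ->
    last b1 cs = b2 -> x \notin b1 :: cs ->
  exists M : R, forall ys1 ys2,
    let y1 := iter i (rot x) b1 in let y2 := iter k (rot x) b1 in
    path e y1 ys1 -> x \notin y1 :: ys1 ->
    (forall v, v \in y1 :: ys1 -> v \notin b1 :: cs) ->
    path e y2 ys2 -> x \notin y2 :: ys2 ->
    (forall v, v \in y2 :: ys2 -> v \notin b1 :: cs) ->
    M < `|pos G (last y1 ys1)| -> M < `|pos G (last y2 ys2)| -> False.
Proof.
move=> uN memN b1 cs i j k b2 exb1 /andP[i0 ij] /andP[jk kN] csP csl xcs.
have exb2 : e x b2 by apply: (rot_edge rotM).
have exi l : e x (iter l (rot x) b1) by apply: (rot_edge rotM).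
have ik : (0 < i < k)%N by rewrite i0 (ltn_trans ij).
have jk0 : (0 < j < k)%N by rewrite jk (ltn_trans i0).
have ij0 : (0 < i < j)%N by rewrite i0.
have jN : (j < size N)%N by apply: ltn_trans kN.
case: (rotG x) => acw_rot.
  have acw := acw_iter_rot rotM uN memN (@anticlockwise_cyc x)
    (@anticlockwise_trans x) acw_rot exb1.
  have [M HM] := no_alternating_paths G irr_e exb1 exb2 csP csl xcs.
  exists M => ys1 ys2 y1 y2; apply: HM => //; first exact: (exi i).
  - exact: (exi k).
  - exact: acw ij0 jN.
  exact: acw jk0 kN.
pose cw a b c := anticlockwise G x b a c.
have cw_cyc a b c : cw a b c -> cw b c a by move=> /anticlockwise_cyc/anticlockwise_cyc.
have cw_trans a b c d : cw a b c -> cw a c d -> cw a b d.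
  move=> /anticlockwise_cyc H1 /anticlockwise_cyc H2.
  by apply/anticlockwise_cyc/anticlockwise_cyc; apply: anticlockwise_trans H2 H1.
have acw := acw_iter_rot rotM uN memN cw_cyc cw_trans acw_rot exb1.
have csP' : path e b2 (rev (belast b1 cs)).
  by rewrite -csl rev_path; apply: sub_path csP => a b /=; rewrite sym_e.
have csl' : last b2 (rev (belast b1 cs)) = b1.
  by move: csl; case: (cs) => //= b s _; rewrite rev_cons last_rcons.
have memcs v : (v \in b2 :: rev (belast b1 cs)) = (v \in b1 :: cs).
  by rewrite -csl -rev_rcons mem_rev -lastI.
have xcs' : x \notin b2 :: rev (belast b1 cs) by rewrite memcs.
have [M HM] := no_alternating_paths G irr_e exb2 exb1 csP' csl' xcs'.
exists M => ys1 ys2 y1 y2 p1 x1 c1 p2 x2 c2; apply: HM => //.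
- exact: (exi i).
- exact: (exi k).
- by apply/anticlockwise_cyc/anticlockwise_cyc; apply: acw ij0 jN.
- exact: acw jk0 kN.
- by move=> v /c1; rewrite memcs.
by move=> v /c2; rewrite memcs.
Qed.

End Anticlockwise.

(** * Finite cuts *)

Section Cuts.
Local Open Scope classical_set_scope.
Variables (V : choiceType) (e : rel V).
Hypotheses (sym_e : symmetric e) (irr_e : irreflexive e) (conn : connected_graph e).
Variable N : V -> seq V.
Hypotheses (uN : forall v, uniq (N v)) (memN : forall v w, (w \in N v) = e v w).

Definition joined (S : set V) v w :=
  exists p, [/\ path e v p, last v p = w & forall u, u \in v :: p -> S u].

Lemma joined_mem S v w : joined S v w -> S v /\ S w.
Proof. by case=> p [_ <- Sp]; split; apply: Sp; rewrite ?mem_head ?mem_last. Qed.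

Lemma joined_refl (S : set V) v : S v -> joined S v v.
Proof. by move=> Sv; exists [::]; split=> // u; rewrite inE => /eqP->. Qed.

Lemma joined_trans S u v w : joined S u v -> joined S v w -> joined S u w.
Proof.
move=> [p [pP pl Sp]] [q [qP ql Sq]]; exists (p ++ q); split.
- by rewrite cat_path pP pl qP.
- by rewrite last_cat pl.
move=> z; rewrite -cat_cons mem_cat => /orP[/Sp//|zq].
by apply: Sq; rewrite inE zq orbT.
Qed.

Lemma joined_sym S v w : joined S v w -> joined S w v.
Proof.
move=> [p [pP pl Sp]]; exists (rev (belast v p)); split.
- by rewrite -pl rev_path; apply: sub_path pP => a b /=; rewrite sym_e.
- by move: pl; case: (p) => //= b s _; rewrite rev_cons last_rcons.
by move=> u; rewrite -pl -rev_rcons mem_rev -lastI; apply: Sp.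
Qed.

Lemma joined_sub (S T : set V) v w : S `<=` T -> joined S v w -> joined T v w.
Proof. by move=> ST [p [pP pl Sp]]; exists p; split=> // u /Sp/ST. Qed.

Lemma joined_edge (S : set V) v w : e v w -> S v -> S w -> joined S v w.
Proof.
move=> evw Sv Sw; exists [:: w]; split; rewrite //= ?evw //.
by move=> u; rewrite !inE => /orP[] /eqP->.
Qed.

Lemma joined_path S v p u : path e v p -> (forall w, w \in v :: p -> S w) ->
  u \in v :: p -> joined S v u.
Proof.
move=> pP Sp up; case/splitPl: up pP Sp => p1 p2 pE pP Sp; exists p1; split => //.
  by move: pP; rewrite cat_path => /andP[].
by move=> w wp; apply: Sp; rewrite -cat_cons mem_cat wp.
Qed.

(** Paths from one base vertex to all elements of [A] suffice. *)
Lemma connected_hull (A : seq V) : exists2 B : seq V, {subset A <= B} &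
  forall u v, u \in B -> v \in B -> joined [set` B] u v.
Proof.
case: A => [|o A]; first by exists [::].
have /choice[p pP] : forall a, exists p, path e o p /\ last o p = a.
  by move=> a; have [p pP pl] := conn o a; exists p.
exists (o :: flatten [seq p a | a <- A]).
  move=> a; rewrite !inE => /orP[->//|aA]; have [_ la] := pP a.
  have := mem_last o (p a); rewrite la inE => /orP[->//|ap].
  by apply/orP; right; apply/flattenP; exists (p a) => //; apply: map_f.
set B := o :: _; have fromo v : v \in B -> joined [set` B] o v.
  move=> vB; have [->|vo] := eqVneq v o; first by apply: joined_refl; apply: mem_head.
  move: (vB); rewrite inE (negbTE vo) => /flattenP[_ /mapP[a aA ->] vp].
  apply: (@joined_path _ o (p a)); rewrite ?inE ?vp ?orbT //; first by case: (pP a).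
  move=> w; rewrite /= inE => /orP[/eqP->|wp]; first exact: mem_head.
  by rewrite /= inE; apply/orP; right; apply/flattenP; exists (p a) => //; apply: map_f.
by move=> u v uB vB; apply: joined_trans (fromo v vB); apply/joined_sym/fromo.
Qed.

Section Boundary.
Variable B : seq V.
Hypothesis connB : forall u v, u \in B -> v \in B -> joined [set` B] u v.

Definition off x : set V := [set v | v \notin x :: B].
Definition comp x v : set V := [set w | joined (off x) v w].

(* The finite components of the complement of [x :: B]: those touching [B] are
   added to [B], those hanging at [x] alone may lie anywhere around [x]. *)
Definition filled x : set V := [set v | off x v /\ finite_set (comp x v) /\
  exists2 w, comp x v w & exists2 b, b \in B & e b w].
Definition hanging x : set V := [set v | off x v /\ finite_set (comp x v) /\
  ~ (exists2 w, comp x v w & exists2 b, b \in B & e b w) /\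
  exists2 w, comp x v w & e x w].

Lemma comp_eq x v w : comp x v w -> comp x w = comp x v.
Proof.
move=> vw; apply/seteqP; split=> u.
  exact: joined_trans.
by apply: joined_trans; apply: joined_sym.
Qed.

Lemma filled_comp x v w : filled x v -> comp x v w -> filled x w.
Proof.
move=> [ov [fv tv]] vw; have [_ ow] := joined_mem vw.
by split=> //; rewrite (comp_eq vw).
Qed.

Lemma hanging_comp x v w : hanging x v -> comp x v w -> hanging x w.
Proof.
move=> [ov [fv tv]] vw; have [_ ow] := joined_mem vw.
by split=> //; rewrite (comp_eq vw).
Qed.

Lemma finite_by_comp x (S : set V) (s : seq V) :
    (forall v, S v -> finite_set (comp x v) /\ exists2 w, comp x v w & w \in s) ->
  finite_set S.
Proof.
move=> H; apply: (@sub_finite_set _ _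
  (\bigcup_(w in [set w | w \in s /\ finite_set (comp x w)]) comp x w)).
  move=> v /H[fv [w vw ws]]; exists w; last exact: joined_sym.
  by split; rewrite // (comp_eq vw).
apply: bigcup_finite; last by move=> w [].
by apply: (@sub_finite_set _ _ [set` s]) => // w [].
Qed.

Definition bd : seq V := [seq w <- flatten [seq N b | b <- B] | w \notin B].

Lemma mem_bd w : w \in bd <-> w \notin B /\ exists2 b, b \in B & e b w.
Proof.
rewrite mem_filter; split.
  case/andP=> -> /flattenP[_ /mapP[b bB ->]]; rewrite memN => ebw.
  by split=> //; exists b.
case=> -> [b bB ebw]; apply/flattenP; exists (N b); first exact: map_f.
by rewrite memN.
Qed.

Lemma finite_filled x : finite_set (filled x).
Proof.
apply: (@finite_by_comp x _ bd) => v [_ [fv [w vw [b bB ebw]]]]; split=> //.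
exists w => //; apply/mem_bd; split; last by exists b.
by have [_] := joined_mem vw; rewrite /off /= inE negb_or => /andP[].
Qed.

Lemma finite_hanging x : finite_set (hanging x).
Proof.
apply: (@finite_by_comp x _ (N x)) => v [_ [fv [_ [w vw exw]]]]; split=> //.
by exists w => //; rewrite memN.
Qed.

(** The filling is done for all boundary vertices at once; by [filled_edge] a vertex outside the
    hull is adjacent to no filling but its own. *)
Definition hull : set V := [set` B] `|` \bigcup_(x in [set` bd]) filled x.

Lemma finite_hull : finite_set hull.
Proof.
by rewrite finite_setU; split=> //; apply: bigcup_finite => // x _; apply: finite_filled.
Qed.

Section BoundaryVertex.
Variable x : V.
Hypotheses (xU : ~ hull x) (xnb : exists2 u, hull u & e x u).

Lemma notin_B : x \notin B.
Proof. by apply/negP => xB; apply: xU; left. Qed.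

(** Otherwise [x], which avoids [x'] and [B], would belong to the component of [v] and hence to the
    hull. *)
Lemma filled_edge x' v : x' \in bd -> filled x' v -> e x v -> x' = x.
Proof.
move=> x'bd fv exv; have [//|x'x] := eqVneq x' x; exfalso; apply: xU; right.
exists x' => //; apply: (filled_comp fv); apply: joined_edge; first by rewrite sym_e.
  by case: fv.
by rewrite /off /= inE negb_or eq_sym x'x notin_B.
Qed.

Lemma x_bd : x \in bd.
Proof.
case: xnb => u [uB|[x' x'bd fu]] exu; last by rewrite -(filled_edge x'bd fu exu).
by apply/mem_bd; split; [exact: notin_B | exists u; rewrite // sym_e].
Qed.

Lemma hull_edge v : e x v -> hull v -> ([set` B] `|` filled x) v.
Proof.
move=> exv [vB|[x' x'bd fv]]; [by left | right].
by rewrite -(filled_edge x'bd fv exv).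
Qed.

(** A finite component next to [x] either touches [B] and is filled in, or hangs at [x]. *)
Lemma edge_cases v : e x v -> ~ hull v -> ~ hanging x v ->
  off x v /\ infinite_set (comp x v).
Proof.
move=> exv nhv nP; have ov : off x v.
  rewrite /off /= inE negb_or; apply/andP; split.
    by apply: contraTneq exv => ->; rewrite irr_e.
  by apply/negP => vB; apply: nhv; left.
split=> // fv.
have [tv|ntv] := pselect (exists2 w, comp x v w & exists2 b, b \in B & e b w).
  by apply: nhv; right; exists x; [exact: x_bd | split].
apply: nP; split=> //; split=> //; split=> //; exists v => //.
exact: joined_refl.
Qed.

Lemma hanging_hull v : hanging x v -> e x v -> ~ hull v.
Proof.
move=> [ov [fv [ntv _]]] exv /(hull_edge exv)[vB|[_ [_]] //].
by move: ov; rewrite /off /= inE vB orbT.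
Qed.

Lemma hanging_exit v w : hanging x v -> e v w -> ~ hanging x w -> w = x.
Proof.
move=> Pv evw nPw; have [//|wx] := eqVneq w x; exfalso.
have ov : off x v by case: Pv.
have [wB|wB] := boolP (w \in B).
  case: Pv => _ [_ [ntv _]]; apply: ntv; exists v; first exact: joined_refl.
  by exists w; rewrite // sym_e.
apply: nPw; apply: hanging_comp Pv _; apply: joined_edge => //.
by rewrite /off /= inE negb_or wx wB.
Qed.

(** This supplies the path that closes up to a cycle through [x]: every filled component touches
    [B], which is connected. *)
Lemma joined_inner u v : ([set` B] `|` filled x) u -> ([set` B] `|` filled x) v ->
  joined ([set` B] `|` filled x) u v.
Proof.
have toB w : ([set` B] `|` filled x) w -> exists2 b, b \in B &
    joined ([set` B] `|` filled x) w b.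
  case=> [wB|fw]; first by exists w => //; apply: joined_refl; left.
  have [_ [_ [w' ww' [b bB ebw']]]] := fw; exists b => //.
  apply: (@joined_trans _ _ w').
    case: ww' => p [pP pl op]; exists p; split=> // z zp; right.
    by apply: filled_comp fw _; apply: joined_path zp.
  apply: joined_edge; first by rewrite sym_e.
    by right; apply: filled_comp fw ww'.
  by left.
move=> /toB[b bB ub] /toB[c cB vc]; apply: joined_trans ub _.
apply: joined_trans (joined_sym vc); apply: joined_sub (connB bB cB).
exact: subsetUl.
Qed.

Lemma infinite_comp_avoids v w : infinite_set (comp x v) -> comp x v w ->
  ~ ([set` B] `|` filled x) w.
Proof.
move=> iv vw [wB|[_ [fw _]]]; last by apply: iv; rewrite -(comp_eq vw).
by have [_] := joined_mem vw; rewrite /off /= inE (_ : w \in B) ?orbT.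
Qed.

End BoundaryVertex.
End Boundary.
End Cuts.

(** * Existence of cuts and assembly of the rotor configuration *)

Section Main.
Local Open Scope classical_set_scope.
Variables (R : realType) (V : choiceType) (e : rel V) (G : planar_embedding R e).
Variable rot : V -> V -> V.
Hypotheses (sym_e : symmetric e) (irr_e : irreflexive e) (conn : connected_graph e).
Hypothesis lfG : locally_finite_embedding G.
Hypothesis rotM : rotor_mechanism e rot.
Hypothesis rotG : forall x, anticlockwise_at G rot x \/ clockwise_at G rot x.
Variable N : V -> seq V.
Hypotheses (uN : forall v, uniq (N v)) (memN : forall v w, (w \in N v) = e v w).

(** By local finiteness only finitely many vertices have norm at most [M]. *)
Lemma escape_route B x v (M : R) : infinite_set (comp e B x v) ->
  exists ys, [/\ path e v ys, forall u, u \in v :: ys -> comp e B x v u &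
    (M < `|pos G (last v ys)|)%R].
Proof.
move=> iv; have finM : finite_set [set w | (`|pos G w| <= M)%R].
  apply: (lfG (A := [set a | (`|a| <= M)%R])).
  exists M; split; first exact: num_real.
  by move=> c Mc a /= aM; apply: le_trans aM (ltW Mc).
have [w [vw wM]] : exists w, comp e B x v w /\ (M < `|pos G w|)%R.
  apply: contrapT => H; apply: iv; apply: sub_finite_set finM => w vw /=.
  by rewrite leNgt; apply/negP => lt; apply: H; exists w.
have [ys [ysP ysl ysS]] := vw; exists ys; split; rewrite ?ysl //.
by move=> u; apply: joined_path ysP ysS.
Qed.

Lemma exists_cut (A : seq V) : exists2 U : seq V, {subset A <= U} &
  forall x, x \notin U -> (exists2 u, u \in U & e x u) ->
    exists2 y, e x y & good_cut e rot N A U x y.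
Proof.
have [B AB connB] := connected_hull sym_e conn A.
have /finite_seqP[U UE] := finite_hull sym_e memN B.
have memU v : (v \in U) <-> hull e N B v by rewrite UE.
exists U => [a /AB aB|x xU [u uU exu]]; first by apply/memU; left.
have nhx : ~ hull e N B x by move/memU; rewrite (negbTE xU).
have xnb : exists2 u, hull e N B u & e x u by exists u => //; apply/memU.
have /finite_seqP[P PE] := finite_hanging sym_e memN B x.
have memP v : (v \in P) <-> hanging e B x v by rewrite PE.
pose O := [pred v | (v \notin U) && (v \notin P)].
suff [y exy yP] : exists2 y, e x y & forall i j, 0 < i < j -> j <= size (N x) ->
    iter j (rot x) y \in U -> ~~ O (iter i (rot x) y).
  exists y => //; exists P; split.
  - split; first by apply/negP => /memP[]; rewrite /off /= mem_head.
    move=> v w /memP Pv evw /negP nPw; apply: (hanging_exit sym_e Pv evw).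
    by move/memP.
  - by move=> v /memP Pv exv; apply/negP => /memU; apply: hanging_hull Pv exv.
  - move=> v /AB vB; apply/negP => /memP[]; rewrite /off /= inE negb_or => /andP[_].
    by rewrite vB.
  move=> i j ij jN jU iP; have := yP i j ij jN jU.
  by rewrite /= iP andbT negbK.
apply: (rotor_choice rotM (uN x) (memN x) exu (I := mem U)).
  by move=> v /= vU; rewrite vU.
move=> y i j k exy /andP[i0 ij] /andP[jk kN] Oy Ui Oj Uk.
(* The alternation is read off from the inner neighbour [b1] on, so that the outer neighbour [y]
   comes last, after [d - i] steps. *)
set b1 := iter i (rot x) y in Ui; pose d := size (N x).
have ery l : e x (iter l (rot x) y) by apply: (rot_edge rotM).
have b1j : iter (j - i) (rot x) b1 = iter j (rot x) y by rewrite -iterD subnK // ltnW.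
have b1k : iter (k - i) (rot x) b1 = iter k (rot x) y.
  by rewrite -iterD subnK // ltnW // (ltn_trans ij).
have b1d : iter (d - i) (rot x) b1 = y.
  rewrite -iterD subnK ?(iter_rot_size rotM (uN x) (memN x)) //.
  by rewrite ltnW // (ltn_trans ij) // (ltn_trans jk).
have inner v : v \in U -> e x v -> ([set` B] `|` filled e B x) v.
  by move=> /memU hv exv; apply: (hull_edge sym_e nhx exv hv).
have outer v : O v -> e x v -> off B x v /\ infinite_set (comp e B x v).
  move=> /andP[/negP vU /negP vP] exv.
  by apply: (edge_cases sym_e irr_e memN nhx xnb exv); [move/memU | move/memP].
have [cs [csP csl csS]] :=
  joined_inner sym_e connB (inner _ Ui (ery i)) (inner _ Uk (ery k)).
have xcs : x \notin b1 :: cs.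
  apply/negP => /csS[xB|[]]; last by rewrite /off /= mem_head.
  by apply: nhx; left.
rewrite -b1k in csl.
have ij' : 0 < j - i < k - i by lia.
have kd' : k - i < d - i < d by rewrite /d; lia.
have [M] := no_rotor_alternation irr_e sym_e rotM rotG (uN x) (memN x) (ery i)
  ij' kd' csP csl xcs.
rewrite -/b1 b1j b1d => HM.
have [_ infj] := outer _ Oj (ery j); have [_ infy] := outer _ Oy exy.
have [ys1 [ysP1 ysS1 far1]] := escape_route M infj.
have [ys2 [ysP2 ysS2 far2]] := escape_route M infy.
have x_comp v : ~ comp e B x v x.
  by move=> vx; have [_] := joined_mem vx; rewrite /off /= mem_head.
apply: (HM ys1 ys2 ysP1 _ _ ysP2 _ _ far1 far2).
- by apply/negP => /ysS1/x_comp.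
- by move=> v /ysS1 jv; apply/negP => /csS; apply: infinite_comp_avoids infj jv.
- by apply/negP => /ysS2/x_comp.
- by move=> v /ysS2 yv; apply/negP => /csS; apply: infinite_comp_avoids infy yv.
Qed.

Lemma exists_recurrent_configuration : (forall x, exists y, e x y) ->
  exists rho, rotor_configuration e rho /\ recurrent_configuration rot rho.
Proof.
move=> nb; have [[v0 _]|noV] := pselect (exists x : V, True); last first.
  by exists id; split=> x; case: noV; exists x.
have /choice[cut cutP] : forall A : seq V, exists U : seq V, {subset A <= U} /\
    forall x, x \notin U -> (exists2 u, u \in U & e x u) ->
      exists2 y, e x y & good_cut e rot N A U x y.
  by move=> A; have [U AU HU] := exists_cut A; exists U.
(* Adding all neighbours of a cut puts its boundary inside the next one, so a vertex is on the
   boundary of at most one [U n]. *)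
pose next A := cut A ++ flatten [seq N u | u <- cut A].
pose A n := iter n next [:: v0]; pose U n := cut (A n).
have AU n : {subset A n <= U n} by case: (cutP (A n)).
have UA n : {subset U n <= A n.+1} by move=> v vU; rewrite /= mem_cat vU.
have NA n u v : u \in U n -> e u v -> v \in A n.+1.
  move=> uU euv; rewrite /= mem_cat; apply/orP; right; apply/flattenP.
  by exists (N u); [exact: map_f | rewrite memN].
have Amono m n : m <= n -> {subset A m <= A n}.
  move=> /subnKC <-; elim: (n - m) => [|k IHk] v; first by rewrite addn0.
  by move=> /IHk/AU/UA; rewrite addnS.
have Acover v : exists n, v \in A n.
  have [p] := conn v0 v; elim/last_ind: p v => [|p w IHp] v.
    by move=> _ <-; exists 0; rewrite mem_head.
  rewrite rcons_path last_rcons => /andP[/IHp/(_ erefl)[n lA] lw] <-.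
  by exists n.+1; apply: NA lw; apply: AU.
have Acovers (S : seq V) : exists n, {subset S <= A n}.
  elim: S => [|v S [n IHn]]; first by exists 0.
  have [m vA] := Acover v; exists (maxn m n) => w; rewrite inE => /orP[/eqP->|/IHn].
    by apply: Amono vA; apply: leq_maxl.
  by apply: Amono; apply: leq_maxr.
have bd_lt m n x : x \notin U n -> (exists2 u, u \in U m & e x u) -> n <= m.
  move=> xU [u uU exu]; rewrite leqNgt; apply: contra xU => mn.
  by apply/AU/(Amono _ _ mn)/(NA _ _ _ uU); rewrite sym_e.
have /choice[rho rhoP] : forall x, exists y, e x y /\ forall n, x \notin U n ->
    (exists2 u, u \in U n & e x u) -> good_cut e rot N (A n) (U n) x y.
  move=> x; have [[n [xU xnb]]|H] := pselect (exists n, x \notin U n /\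
      exists2 u, u \in U n & e x u).
    have [y exy yP] := (cutP (A n)).2 x xU xnb.
    exists y; split=> // m xUm xnbm; suff -> : m = n by [].
    by apply/eqP; rewrite eqn_leq (bd_lt _ _ _ xUm xnb) (bd_lt _ _ _ xU xnbm).
  have [y exy] := nb x; exists y; split=> // n xU xnb; case: H; by exists n.
have rho_e : rotor_configuration e rho by move=> x; case: (rhoP x).
exists rho; split=> //.
apply: (recurrent_of_cuts rotM uN memN sym_e conn rho_e) => S.
(* A cut made for [A n] serves [S] as well, since pockets missing [A n] miss [S]. *)
have [n SA] := Acovers S; exists (U n) => [v /SA/AU //|x xU xnb].
have [P [pP PU AP inner]] := (rhoP x).2 n xU xnb.
by exists P; split=> // v /SA; apply: AP.
Qed.

End Main.

Theorem theorem3 (R : realType) (V : choiceType) (e : rel V)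
    (G : planar_embedding R e) (rot : V -> V -> V) :
  simple_graph e ->
  infinite_set [set: V]%classic ->
  connected_graph e ->
  (forall x, finite_set (nbrs e x)) ->
  locally_finite_embedding G ->
  rotor_mechanism e rot ->
  (forall x, anticlockwise_at G rot x \/ clockwise_at G rot x) ->
  exists rho : V -> V,
    rotor_configuration e rho /\ recurrent_configuration rot rho.
Proof.
move=> [sym_e irr_e] infV conn finN lfG rotM rotG.
have /choice[N NP] : forall x, exists s : seq V, uniq s /\ forall y, (y \in s) = e x y.
  move=> x; have /finite_seqP[s sE] := finN x; exists (undup s).
  split=> [|y]; first exact: undup_uniq.
  rewrite mem_undup; have E : nbrs e x y <-> y \in s by rewrite sE.
  by apply/idP/idP => /E.
apply: (@exists_recurrent_configuration R V e G rot sym_e irr_e conn lfG rotM rotG N).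
- by move=> x; case: (NP x).
- by move=> x; case: (NP x).
(* By connectedness a vertex without neighbours would be the only vertex. *)
move=> x; apply: contrapT => nox; apply: infV.
apply: (@sub_finite_set _ _ [set x]) => // y _ /=.
have [[|z p] /=] := conn x y; first by [].
by case/andP=> exz; case: nox; exists z.
Qed.
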